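(* If $G$ is a planar and $K_3$-free graph on $n$ vertices (with $n\ge 1$), then $$\psi_3 (G) \le \frac{121}{192}\; n-\frac{3}{8}.$$
   Context: Graphs are finite, simple and undirected, with nonempty vertex set. $K_3$-free means containing no triangle. $P_k$ denotes the path with $k$ vertices. A $k$-path vertex cover of $G$ is a set $T\subseteq V(G)$ such that $G-T$ contains no (not necessarily induced) subgraph isomorphic to $P_k$. $\psi_k(G)$ is the minimum cardinality of a $k$-path vertex cover of $G$. *)

(* Defs.v *)
From HB Require Import structures.
From mathcomp Require Import all_boot all_order all_algebra.
From mathcomp Require Import all_classical all_reals all_analysis.
Set Implicit Arguments.
Unset Strict Implicit.
Unset Printing Implicit Defensive.
Import Order.TTheory GRing.Theory Num.Theory.
Import numFieldNormedType.Exports.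

(* A finite simple graph is a symmetric and irreflexive relation on a finType;
   symmetry and irreflexivity are hypotheses of the statements, not of the
   definitions below. *)

(* In an irreflexive symmetric relation the three vertices are automatically
   pairwise distinct. *)
Definition K3_free (T : finType) (e : rel T) : Prop :=
  forall x y z : T, ~ [/\ e x y, e y z & e x z].

(* A (not necessarily induced) copy of P_k, listed along the path. *)
Definition is_kpath (T : finType) (e : rel T) (k : nat) (p : k.-tuple T) : bool :=
  uniq p && sorted e p.

Definition kpath_vertex_cover (T : finType) (e : rel T) (k : nat)
    (S : {set T}) : bool :=
  ~~ [exists p : k.-tuple T, is_kpath e p && all (fun x => x \notin S) p].

Lemma kpath_vertex_cover_setT (T : finType) (e : rel T) (k : nat) :
  (0 < k)%N -> kpath_vertex_cover e k [set: T].
Proof.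
case: k => // k _; apply/existsPn => p; case/tupleP: p => x p /=.
by rewrite finset.in_setT /= andbF.
Qed.

(* For k > 0 the whole vertex set is a cover, so this is a genuine minimum;
   for k = 0 there is no cover and the value is meaningless. *)
Definition psi (T : finType) (e : rel T) (k : nat) : nat :=
  #|[arg min_(S < [set: T] | kpath_vertex_cover e k S) #|S| ]|.

Lemma psiP (T : finType) (e : rel T) (k : nat) : (0 < k)%N ->
  (exists2 S : {set T}, kpath_vertex_cover e k S & #|S| = psi e k) /\
  (forall S : {set T}, kpath_vertex_cover e k S -> (psi e k <= #|S|)%N).
Proof.
move=> k_gt0; rewrite /psi.
case: arg_minnP => [|S covS minS]; first exact: kpath_vertex_cover_setT.
by split=> //; exists S.
Qed.

Definition edges (T : finType) (e : rel T) : {set {set T}} :=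
  [set [set p.1; p.2] | p : T * T & e p.1 p.2].

Local Open Scope classical_set_scope.
Local Open Scope ring_scope.

(* A Jordan arc in the plane R * R, parametrised by the unit interval. *)
Definition jordan_arc (R : realType) (g : R -> R * R) : Prop :=
  {within `[0, 1], continuous g} /\ {in `[0, 1] &, injective g}.

(* The vertices are distinct points; every edge is an arc between its two ends;
   the interior of an edge contains no vertex and meets the interior of no
   other edge.  The values of [g] outside [edges e] are irrelevant. *)
Definition plane_drawing (R : realType) (T : finType) (e : rel T)
    (pos : T -> R * R) (g : {set T} -> R -> R * R) : Prop :=
  [/\ injective pos,
      forall E, E \in edges e ->
        jordan_arc (g E) /\ [set g E 0; g E 1] = pos @` [set` E],
      forall E x, E \in edges e -> ~ (g E @` `]0, 1[) (pos x)
    & forall E F, E \in edges e -> F \in edges e -> E != F ->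
        (g E @` `]0, 1[) `&` (g F @` `]0, 1[) = set0].

Definition planar (R : realType) (T : finType) (e : rel T) : Prop :=
  exists (pos : T -> R * R) (g : {set T} -> R -> R * R), plane_drawing e pos g.

(* Main.v *)
Require Import Defs.
From Stdlib Require Import NArith ZifyN Lia.
From mathcomp Require Import all_boot all_order all_algebra.
From mathcomp Require Import zify ring lra.
From mathcomp Require boolp.
Set Implicit Arguments.
Unset Strict Implicit.
Unset Printing Implicit Defensive.
Import Order.TTheory GRing.Theory Num.Theory.

(** A dissociation set is a set D of vertices inducing a graph of maximum
    degree at most 1.  Its complement meets every path on three vertices, so
    psi_3 <= n - |D|, and it is enough to find D with 384 |D| >= 142 n + 144.
    The proof joins two facts.

    The first, [dissociation_bound], is combinatorial: a triangle-free graph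
    with n vertices and m edges, none of whose nonempty induced subgraphs is
    4-regular, has a dissociation set with 384 |D| >= 242 n - 50 m.  In a
    minimal counterexample no set D can be kept while deleting a set R that
    contains D and all the neighbours of D, unless this costs more than it
    gains ([irreducible]).  The weights make the deletion of a vertex of degree
    at least 5 free, so all degrees are at most 4.  A search over all the
    possible shapes of a neighbourhood of a vertex, proved sound
    ([check_sound]) and run by computation, finds a profitable pair D, R around
    every vertex of degree at most 2 and around every edge that joins a vertex
    of degree 3 to a vertex of degree 4.  What remains is a graph in which the
    vertices of degree 4 induce a 4-regular graph, hence do not exist, and
    which is therefore cubic; the sides of a maximum cut of a cubic graph are
    dissociation sets, and the larger one has at least n/2 vertices.

    The second, [planar_degree_sum], is the bound m <= 2k - 4 for the number m
    of edges inside a set of k >= 3 vertices of a triangle-free planar graph.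
    It excludes 4-regular subgraphs and, put into the first bound, gives
    384 |D| >= 142 n + 200 for n >= 3.

    Euler's formula is reached without the Jordan curve theorem.  The arcs of
    the drawing are replaced by polygonal lines that may cross themselves but
    not one another, and that are straight near the vertices
    ([clean_of_arcs]).  A point of the plane that lies on no edge defines a
    linear form on the even edge sets (the cycle space over F_2): the parity of
    its winding number.  These forms play the role of the faces.  The two sides
    of an edge i carry forms that differ exactly by z |-> [i in z], and going
    round a vertex shows that the edges bordering a given form again make an
    even set ([sides_at]).  So every even set is a combination of these
    boundaries, which all have at least four edges because there is no
    triangle, and each edge lies in at most two of them; counting dimensions
    gives the bound ([euler_bound]).  The main geometric input is the parity
    identity [parity4] for two disjoint segments, from which the invariance of
    winding parities follows by telescoping. *)

(** * Search for reducible configurations *)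

Definition nbrs_in (T : finType) (e : rel T) (S : {set T}) (x : T) : {set T} :=
  [set y in S | e x y].

(** A partially explored neighbourhood: the i-th entry holds the degree of the
    i-th vertex found and the indices of its known neighbours.  A vertex is
    [full] once all its neighbours are known. *)
Definition state := seq (nat * seq nat).

Definition deg_of (s : state) i := (nth (0, [::]) s i).1.
Definition nbs_of (s : state) i := (nth (0, [::]) s i).2.
Definition full (s : state) i := size (nbs_of s i) == deg_of s i.

(** Non-adjacency is never recorded: it follows from one end being full or
    from a common neighbour, by triangle-freeness.  The conditionals, here and
    below, keep call-by-value evaluation from computing the later tests. *)
Definition unknown (s : state) i j :=
  if full s j then false else if full s i then false else
  if i == j then false else if j \in nbs_of s i then false else
  ~~ has (mem (nbs_of s j)) (nbs_of s i).

Definition link (s : state) i j : state :=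
  set_nth (0, [::]) s i (deg_of s i, j :: nbs_of s i).

Definition add_edge s i j := link (link s i j) j i.

Definition add_vertex s i d := rcons (link s i (size s)) (d, [:: i]).

(** The ways to choose which of the vertices [js] are neighbours of [i]; not
    choosing one leaves no trace, since [i] becomes full afterwards. *)
Fixpoint splits s i js : seq state :=
  if js is j :: js' then
    splits s i js' ++
    (if unknown s i j then splits (add_edge s i j) i js' else [::])
  else [:: s].

(** New vertices are interchangeable, so their degrees are enumerated only up
    to order. *)
Fixpoint multisets (A : seq nat) r : seq (seq nat) :=
  if A is d :: A' then
    flatten [seq [seq nseq k d ++ m | m <- multisets A' (r - k)] | k <- iota 0 r.+1]
  else if r is 0 then [:: [::]] else [::].

Definition add_vertices s i ds := foldl (fun s d => add_vertex s i d) s ds.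

Definition children A s i :=
  flatten [seq [seq add_vertices s' i ds | ds <- multisets A (deg_of s' i - size (nbs_of s' i))]
          | s' <- splits s i (iota 0 (size s))].

Definition region (s : state) (D : seq nat) := undup (D ++ flatten (map (nbs_of s) D)).

(** An upper bound for the degree of [i] inside the region, whatever the
    undecided adjacencies are. *)
Definition inner_bound (s : state) (Rg : seq nat) i :=
  let k := count (mem Rg) (nbs_of s i) in
  if full s i then k else k + minn (deg_of s i - size (nbs_of s i)) (count (unknown s i) Rg).

(** Keeping D and deleting the region Rg does not lose when
    242 |Rg| <= 384 |D| + 50 e, where e is the number of edges meeting Rg, that
    is, the sum of the degrees over Rg minus half the sum of the inner degrees. *)
Definition gain_cond (s : state) (D Rg : seq nat) inner :=
  (242 * N.of_nat (size Rg) + 25 * N.of_nat inner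
    <=? 384 * N.of_nat (size D) + 50 * N.of_nat (sumn (map (deg_of s) Rg)))%num.

Definition gains (s : state) (D : seq nat) :=
  let Rg := region s D in
  (* a cheap necessary condition, which discards most candidates *)
  if gain_cond s D Rg (sumn [seq count (mem Rg) (nbs_of s i) | i <- Rg])
  then gain_cond s D Rg (sumn (map (inner_bound s Rg) Rg)) else false.

Definition reducible (s : state) (D : seq nat) :=
  if D is [::] then false else if gains s D then
    uniq D && all (fun i => [&& i < size s, full s i & count (mem D) (nbs_of s i) <= 1]) D
  else false.

Definition compatible (s : state) (D : seq nat) i :=
  let c := filter (mem D) (nbs_of s i) in
  (size c <= 1) && all (fun j => ~~ has (mem D) (nbs_of s j)) c.

Definition candidates s :=
  foldr (fun i acc => acc ++ [seq i :: D | D <- acc & compatible s D i]) [:: [::]]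
    (filter (full s) (iota 0 (size s))).

(** Completing the vertex with the fewest missing neighbours first keeps the
    search tree small (about two thousand nodes for [root34]). *)
Definition least_open s :=
  let op := filter (fun i => ~~ full s i) (iota 0 (size s)) in
  let res i := deg_of s i - size (nbs_of s i) in
  foldl (fun i j => if res j < res i then j else i) (head 0 op) op.

(** [has] would evaluate the predicate on the whole list under call-by-value. *)
Fixpoint exists_lazy (T : Type) (P : T -> bool) (l : seq T) :=
  if l is x :: l' then if P x then true else exists_lazy P l' else false.

Fixpoint check A fuel s :=
  if exists_lazy (reducible s) (candidates s) then true else
  if fuel is n.+1 then
    let i := least_open s in
    if i < size s then all (check A n) (children A s i) else false
  else false.

Definition root2 : state := [:: (2, [::])].
Definition root34 : state := [:: (3, [:: 1]); (4, [:: 0])].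

Lemma deg2_reducible : check [:: 2; 3; 4] 7 root2.
Proof. by vm_compute. Qed.
Lemma edge34_reducible : check [:: 3; 4] 8 root34.
Proof. by vm_compute. Qed.

Lemma sub_in_count (A : eqType) (a b : pred A) (l : seq A) :
  (forall x, x \in l -> a x -> b x) -> count a l <= count b l.
Proof.
elim: l => //= x l IH ab; apply: leq_add; last by apply: IH => y yl; apply: ab; rewrite in_cons yl orbT.
by case: (a x) (ab x (mem_head _ _)) => // /(_ isT) ->.
Qed.

Section Soundness.
Variables (T : finType) (e : rel T) (S : {set T}) (x0 : T).
Hypotheses (e_sym : symmetric e) (e_irr : irreflexive e) (e_K3_free : K3_free e).

Notation N := (nbrs_in e).

Definition dissociation (D : {set T}) := forall x, x \in D -> #|N D x| <= 1.
Definition degsum (A B : {set T}) := \sum_(x in A) #|N B x|.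

(** What a smallest counterexample to [dissociation_bound] satisfies: extending
    by D a dissociation set found outside R is never profitable enough. *)
Definition irreducible := forall D R : {set T}, R \subset S -> D \subset R -> R != set0 ->
  (forall x, x \in D -> N S x \subset R) -> dissociation D ->
  384 * #|D| + 50 * degsum R S < 242 * #|R| + 25 * degsum R R.

(** [x] lists actual vertices of the graph induced by S that match the
    explored part [s]; nothing is claimed about pairs that [s] does not link. *)
Record realizes (s : state) (x : seq T) : Prop := Realizes {
  real_size : size x = size s;
  real_uniq : uniq x;
  real_sub : {subset x <= S};
  real_deg : forall i, i < size s -> #|N S (nth x0 x i)| = deg_of s i;
  real_nb_uniq : forall i, i < size s -> uniq (nbs_of s i);
  real_nb : forall i j, i < size s -> j \in nbs_of s i ->
    [/\ j < size s, e (nth x0 x i) (nth x0 x j) & i \in nbs_of s j] }.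

Lemma deg_of_link s i j k : i < size s -> deg_of (link s i j) k = deg_of s k.
Proof. by move=> h; rewrite /deg_of /link nth_set_nth /=; case: eqP => // ->. Qed.

Lemma nbs_of_link s i j k : i < size s -> nbs_of (link s i j) k = if k == i then j :: nbs_of s i else nbs_of s k.
Proof. by move=> h; rewrite /nbs_of /link nth_set_nth /=; case: eqP. Qed.

Lemma size_link s i j : i < size s -> size (link s i j) = size s.
Proof. by move=> h; rewrite size_set_nth; apply/maxn_idPr. Qed.

Section Real.
Variables (s : state) (x : seq T).
Hypothesis rs : realizes s x.
Notation X := (nth x0 x).

Lemma X_inj i j : i < size s -> j < size s -> X i = X j -> i = j.
Proof.
move=> hi hj /eqP; rewrite nth_uniq ?(real_size rs) ?(real_uniq rs) //.
by move/eqP.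
Qed.

Lemma X_in i : i < size s -> X i \in S.
Proof. by move=> hi; apply: (real_sub rs); rewrite mem_nth // (real_size rs). Qed.

Lemma uniq_map_X (l : seq nat) : uniq l -> (forall i, i \in l -> i < size s) -> uniq (map X l).
Proof.
by move=> ul hl; rewrite map_inj_in_uniq // => i j /hl hi /hl hj; apply: X_inj.
Qed.

Lemma nb_lt i j : i < size s -> j \in nbs_of s i -> j < size s.
Proof. by move=> hi /(real_nb rs hi)[]. Qed.

Lemma known_sub i : i < size s -> [set y in map X (nbs_of s i)] \subset N S (X i).
Proof.
move=> hi; apply/subsetP => y; rewrite inE => /mapP[j jn ->].
by have [hj ej _] := real_nb rs hi jn; rewrite inE ej X_in.
Qed.

Lemma card_known i : i < size s -> #|[set y in map X (nbs_of s i)]| = size (nbs_of s i).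
Proof.
move=> hi; rewrite cardsE.
have /card_uniqP -> : uniq (map X (nbs_of s i)); last by rewrite size_map.
by apply: uniq_map_X => [|j]; [exact: (real_nb_uniq rs)|exact: nb_lt].
Qed.

Lemma full_closed i : i < size s -> full s i -> N S (X i) = [set y in map X (nbs_of s i)].
Proof.
move=> hi /eqP fi; apply/esym/eqP; rewrite eqEcard known_sub // card_known //.
by rewrite (real_deg rs hi) fi leqnn.
Qed.

Lemma full_nb i j : i < size s -> j < size s -> full s i -> e (X i) (X j) -> j \in nbs_of s i.
Proof.
move=> hi hj fi ej; have : X j \in N S (X i) by rewrite inE ej X_in.
rewrite full_closed // inE => /mapP[k kn /X_inj -> //].
exact: nb_lt kn.
Qed.

(** The three ways in which [unknown] fails all exclude an edge: a full end
    would list it, and a common neighbour would close a triangle. *)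
Lemma unknownI i j : i < size s -> j < size s -> e (X i) (X j) -> j \notin nbs_of s i ->
  unknown s i j.
Proof.
move=> hi hj ej jn; rewrite /unknown.
case: ifP => [fj|_].
  have /(real_nb rs hj)[_ _] : i \in nbs_of s j by apply: full_nb; rewrite // e_sym.
  by rewrite (negbTE jn).
case: ifP => [fi|_]; first by rewrite full_nb // in jn.
case: eqP => [ij|_]; first by rewrite ij e_irr in ej.
rewrite (negbTE jn); apply/hasPn => k /(real_nb rs hi)[hk eik _]; apply/negP => /= kj.
have [_ ejk _] := real_nb rs hj kj.
exact: (e_K3_free (And3 ej ejk eik)).
Qed.

Section Region.
Variable R : seq nat.
Hypotheses (R_uniq : uniq R) (R_lt : forall i, i \in R -> i < size s).

Definition Xset (l : seq nat) : {set T} := [set y in map X l].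

Lemma card_Xset l : uniq l -> (forall i, i \in l -> i < size s) -> #|Xset l| = size l.
Proof. by move=> ul hl; rewrite cardsE (card_uniqP (uniq_map_X ul hl)) size_map. Qed.

Lemma sum_Xset l (F : T -> nat) : uniq l -> (forall i, i \in l -> i < size s) ->
  \sum_(y in Xset l) F y = sumn [seq F (X i) | i <- l].
Proof.
move=> ul hl; rewrite sumnE big_map /= -(big_map X xpredT F) big_uniq ?uniq_map_X //=.
by apply: eq_bigl => y; rewrite inE.
Qed.

Lemma card_nbrs_region i : i < size s -> #|N (Xset R) (X i)| = count (fun j => e (X i) (X j)) R.
Proof.
move=> hi; rewrite -size_filter -(size_map X).
have -> : N (Xset R) (X i) = [set y in [seq X j | j <- R & e (X i) (X j)]].
  apply/setP => y; rewrite !inE; apply/andP/mapP.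
    by move=> [/mapP[j jR ->] ej]; exists j; rewrite // mem_filter ej.
  by move=> [j]; rewrite mem_filter => /andP[ej jR] ->; rewrite ej map_f.
rewrite cardsE; apply/card_uniqP/uniq_map_X; first exact: filter_uniq.
by move=> j; rewrite mem_filter => /andP[_ /R_lt].
Qed.

Lemma count_memC (l1 l2 : seq nat) : uniq l1 -> uniq l2 -> count (mem l1) l2 = count (mem l2) l1.
Proof.
move=> u1 u2; rewrite -!size_filter; apply/perm_size/uniq_perm; rewrite ?filter_uniq //.
by move=> k; rewrite !mem_filter /= andbC.
Qed.

(** For an open vertex the neighbours in the region that are not yet recorded
    are limited both by its missing degree and by the undecided pairs. *)
Lemma inner_boundP i : i < size s -> #|N (Xset R) (X i)| <= inner_bound s R i.
Proof.
move=> hi; rewrite card_nbrs_region // /inner_bound.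
rewrite (count_memC R_uniq (real_nb_uniq rs hi)).
case: ifP => [fi|_].
  by apply: sub_in_count => j jR; apply: full_nb => //; apply: R_lt.
have split : count (fun j => e (X i) (X j)) R <=
    count (mem (nbs_of s i)) R + count (fun j => e (X i) (X j) && (j \notin nbs_of s i)) R.
  rewrite -count_predUI; apply: leq_trans (leq_addr _ _).
  by apply: sub_count => j /= ->; case: (j \in _).
apply: leq_trans split _; rewrite leq_add2l leq_min; apply/andP; split; last first.
  by apply: sub_in_count => j jR /andP[]; apply: unknownI => //; apply: R_lt.
set f := filter (fun j => e (X i) (X j) && (j \notin nbs_of s i)) R.
have fP j : j \in f -> [/\ j < size s, e (X i) (X j) & j \notin nbs_of s i].
  by rewrite mem_filter => /andP[/andP[-> ->] /R_lt ->].
have nbi j := @nb_lt i j hi.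
have ul : uniq (nbs_of s i ++ f).
  rewrite cat_uniq (real_nb_uniq rs) // filter_uniq // andbT.
  by apply/hasPn => j /fP[].
have hl j : j \in nbs_of s i ++ f -> j < size s by rewrite mem_cat => /orP[/nbi|/fP[]].
rewrite -size_filter -/f -(real_deg rs hi) leq_subRL -?card_known ?subset_leq_card ?known_sub //.
rewrite card_known // -size_cat -(card_Xset ul hl); apply: subset_leq_card.
apply/subsetP => y; rewrite inE => /mapP[j].
rewrite mem_cat => jl ->; rewrite inE X_in ?hl ?mem_cat //=.
by case/orP: jl => [/(real_nb rs hi)[_ -> _]|/fP[_ -> _]].
Qed.

End Region.

Lemma reducibleP D : irreducible -> reducible s D -> False.
Proof.
move=> irr; rewrite /reducible; case: D => // d0 D'; set D := d0 :: D'.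
case: ifP => // g /andP[uD /allP allD].
move: g; rewrite /gains; set R := region s D; case: ifP => // _ gc.
have D_lt i : i \in D -> i < size s by move=> /allD/and3P[].
have uR : uniq R by apply: undup_uniq.
have R_lt i : i \in R -> i < size s.
  rewrite mem_undup mem_cat => /orP[/D_lt//|/flatten_mapP[j /D_lt hj]].
  exact: nb_lt.
have DR i : i \in D -> i \in R by move=> h; rewrite mem_undup mem_cat h.
have := irr (Xset D) (Xset R).
rewrite (card_Xset uD D_lt) (card_Xset uR R_lt).
rewrite /degsum (sum_Xset _ uR R_lt) (sum_Xset _ uR R_lt).
have -> : [seq #|N S (X i)| | i <- R] = map (deg_of s) R.
  by apply/eq_in_map => i /R_lt; apply: (real_deg rs).
have le : sumn [seq #|N (Xset R) (X i)| | i <- R] <= sumn (map (inner_bound s R) R).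
  rewrite !sumnE !big_map big_seq [leqRHS]big_seq; apply: leq_sum => i iR.
  by apply: inner_boundP => //; apply: R_lt.
move: gc; rewrite /gain_cond => /N.leb_le gc H.
have {}gc : 242 * size R + 25 * sumn (map (inner_bound s R) R) <=
    384 * size D + 50 * sumn (map (deg_of s) R).
  move: gc; move: (size R) (sumn _) (size D) (sumn _) => a b c d {le}; clear.
  lia.
suff : 384 * size D + 50 * sumn (map (deg_of s) R) <
    242 * size R + 25 * sumn [seq #|N (Xset R) (X i)| | i <- R] by lia.
apply: H.
- by apply/subsetP => y; rewrite inE => /mapP[i /R_lt hi ->]; apply: X_in.
- by apply/subsetP => y; rewrite inE => /mapP[i /DR iR ->]; rewrite inE map_f.
- apply/set0Pn; exists (X d0); rewrite inE; apply: map_f; apply: DR; exact: mem_head.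
- move=> y; rewrite inE => /mapP[i iD ->]; have /and3P[hi fi _] := allD i iD.
  rewrite full_closed //; apply/subsetP => z; rewrite inE => /mapP[j jn ->].
  rewrite inE; apply: map_f; rewrite mem_undup mem_cat; apply/orP; right; apply/flatten_mapP.
  by exists i.
move=> y; rewrite inE => /mapP[i iD ->]; have /and3P[hi fi c1] := allD i iD.
rewrite (card_nbrs_region uD D_lt hi); apply: leq_trans c1.
rewrite (count_memC uD (real_nb_uniq rs hi)).
by apply: sub_in_count => j jD; apply: full_nb => //; apply: D_lt.
Qed.

End Real.

Lemma nbs_of_add_edge s i j k : i < size s -> j < size s -> i != j ->
  nbs_of (add_edge s i j) k = if k == j then i :: nbs_of s j else if k == i then j :: nbs_of s i else nbs_of s k.
Proof.
move=> hi hj ij; rewrite /add_edge nbs_of_link ?size_link // !nbs_of_link //.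
by rewrite [j == i]eq_sym (negbTE ij).
Qed.

Lemma size_add_edge s i j : i < size s -> j < size s -> size (add_edge s i j) = size s.
Proof. by move=> hi hj; rewrite !size_link. Qed.

Lemma deg_of_add_edge s i j k : i < size s -> j < size s -> deg_of (add_edge s i j) k = deg_of s k.
Proof. by move=> hi hj; rewrite !deg_of_link ?size_link. Qed.

Lemma realizes_edge s x i j : realizes s x -> i < size s -> j < size s ->
  e (nth x0 x i) (nth x0 x j) -> j \notin nbs_of s i -> realizes (add_edge s i j) x.
Proof.
move=> rs hi hj eij jn.
have ij : i != j by apply: contraTneq eij => ->; rewrite e_irr.
have ni : i \notin nbs_of s j by apply: contra jn => /(real_nb rs hj)[].
split; rewrite ?size_add_edge //.
- exact: (real_size rs).
- exact: (real_uniq rs).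
- exact: (real_sub rs).
- by move=> k hk; rewrite deg_of_add_edge // (real_deg rs).
- move=> k hk; rewrite nbs_of_add_edge //; case: eqP => [_|_].
    by rewrite /= ni (real_nb_uniq rs).
  by case: eqP => [_|_]; rewrite ?cons_uniq ?jn (real_nb_uniq rs).
move=> k l hk; rewrite !nbs_of_add_edge //.
have [->|kj] := eqVneq k j.
  rewrite in_cons => /predU1P[->|/(real_nb rs hj)[hl el jl]].
    by split=> //; [rewrite e_sym|rewrite (negbTE ij) eqxx mem_head].
  split=> //; have [lj|_] := eqVneq l j; first by rewrite lj e_irr in el.
  by have [lE|_] := eqVneq l i; rewrite ?mem_head.
have [->|ki] := eqVneq k i.
  rewrite in_cons => /predU1P[->|/(real_nb rs hi)[hl el il]].
    by split=> //; rewrite eqxx mem_head.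
  split=> //; have [lj|_] := eqVneq l j; first by rewrite mem_head.
  by have [lE|_] := eqVneq l i => //; rewrite lE e_irr in el.
move=> /(real_nb rs hk)[hl el kl]; split=> //.
have [lE|_] := eqVneq l j; first by rewrite in_cons -lE kl orbT.
by have [lE|_] := eqVneq l i; first by rewrite in_cons -lE kl orbT.
Qed.

(** One branch of the enumeration makes the choices that hold in the graph. *)
Lemma splitsP s x i js : realizes s x -> i < size s -> (forall j, j \in js -> j < size s) ->
  exists s', [/\ s' \in splits s i js, realizes s' x, size s' = size s,
    {subset nbs_of s i <= nbs_of s' i}
    & forall j, j \in js -> e (nth x0 x i) (nth x0 x j) -> j \in nbs_of s' i].
Proof.
elim: js s => [|j js IH] s rs hi hjs; first by exists s; split; rewrite ?mem_head.
have hj : j < size s by apply: hjs; rewrite mem_head.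
have hjs' k : k \in js -> k < size s by move=> kj; apply: hjs; rewrite in_cons kj orbT.
have [/andP[eij jn]|old] := boolP (e (nth x0 x i) (nth x0 x j) && (j \notin nbs_of s i)).
  have ij : i != j by apply: contraTneq eij => ->; rewrite e_irr.
  have sz := size_add_edge hi hj.
  have [||s' [h1 h2 h3 h4 h5]] := IH _ (realizes_edge rs hi hj eij jn).
  - by rewrite sz.
  - by rewrite sz.
  rewrite nbs_of_add_edge // (negbTE ij) eqxx in h4.
  exists s'; split=> //; last 1 first.
  - by move=> k; rewrite in_cons => /predU1P[-> _|/h5]; first by apply: h4; rewrite mem_head.
  - by rewrite /= mem_cat (unknownI rs) // h1 orbT.
  - by rewrite h3.
  - by move=> k kn; apply: h4; rewrite in_cons kn orbT.
have [s' [h1 h2 h3 h4 h5]] := IH s rs hi hjs'.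
exists s'; split=> //; first by rewrite /= mem_cat h1.
move=> k; rewrite in_cons => /predU1P[-> eij|/h5 //]; apply: h4.
by move: old; rewrite eij negbK.
Qed.

Lemma nbs_of_add_vertex s i d k : i < size s ->
  nbs_of (add_vertex s i d) k = if k == size s then [:: i] else
    if k == i then size s :: nbs_of s i else nbs_of s k.
Proof.
move=> hi; rewrite /add_vertex /nbs_of nth_rcons size_link //.
case: ltngtP => hk //=; first by rewrite -/(nbs_of (link s i (size s)) k) nbs_of_link.
have /negbTE -> : k != i by apply: contraTneq hk => ->; rewrite -leqNgt ltnW.
by rewrite nth_default // ltnW.
Qed.

Lemma deg_of_add_vertex s i d k : i < size s -> deg_of (add_vertex s i d) k =
  if k == size s then d else deg_of s k.
Proof.
move=> hi; rewrite /add_vertex /deg_of nth_rcons size_link //.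
case: ltngtP => hk //=; first by rewrite -/(deg_of (link s i (size s)) k) deg_of_link.
by rewrite nth_default // ltnW.
Qed.

Lemma realizes_vertex s x i y : realizes s x -> i < size s -> y \in nbrs_in e S (nth x0 x i) ->
  y \notin x -> realizes (add_vertex s i #|nbrs_in e S y|) (rcons x y).
Proof.
move=> rs hi; rewrite inE => /andP[yS ey] yx.
have sx := real_size rs.
have old k : k < size s -> nth x0 (rcons x y) k = nth x0 x k by move=> hk; rewrite nth_rcons sx hk.
have new : nth x0 (rcons x y) (size s) = y by rewrite nth_rcons sx ltnn eqxx.
have sz : size (add_vertex s i #|nbrs_in e S y|) = (size s).+1 by rewrite size_rcons size_link.
have nlt k : k < size s -> k == size s = false by move=> hk; rewrite ltn_eqF.
split; rewrite ?sz.
- by rewrite size_rcons sx.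
- by rewrite rcons_uniq yx (real_uniq rs).
- by move=> z; rewrite mem_rcons in_cons => /predU1P[->|/(real_sub rs)].
- move=> k; rewrite ltnS leq_eqVlt deg_of_add_vertex //.
  by case: eqVneq => [-> _|_ /= hk]; rewrite ?new ?old // (real_deg rs).
- move=> k; rewrite ltnS leq_eqVlt nbs_of_add_vertex //; case: eqVneq => //= _ hk.
  case: eqVneq => [_|_]; last exact: (real_nb_uniq rs).
  rewrite cons_uniq (real_nb_uniq rs) // andbT; apply/negP => /(real_nb rs hi)[].
  by rewrite ltnn.
move=> k l; rewrite ltnS leq_eqVlt !nbs_of_add_vertex //.
have [-> _|_ /= hk] := eqVneq k (size s).
  rewrite mem_seq1 => /eqP ->; rewrite new old // e_sym ey ltnS ltnW // nlt // eqxx.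
  by rewrite mem_head.
rewrite old //; have [->|ki] := eqVneq k i.
  rewrite in_cons => /predU1P[->|/(real_nb rs hi)[hl el il]].
    by rewrite new eqxx mem_head leqnn.
  rewrite old // el ltnS ltnW // nlt //; split=> //.
  by case: eqVneq => [lE|_] //; rewrite lE e_irr in el.
move=> /(real_nb rs hk)[hl el kl]; rewrite old // el ltnS ltnW // nlt //; split=> //.
by case: eqVneq => [lE|_] //; rewrite in_cons -lE kl orbT.
Qed.

Lemma realizes_vertices ys s x i : realizes s x -> i < size s -> uniq ys ->
  (forall y, y \in ys -> y \in nbrs_in e S (nth x0 x i) /\ y \notin x) ->
  realizes (add_vertices s i [seq #|nbrs_in e S y| | y <- ys]) (x ++ ys).
Proof.
elim: ys s x => [|y ys IH] s x rs hi /=; first by rewrite cats0.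
move=> /andP[yys uys] hys; rewrite -cat_rcons.
have [yN yx] := hys y (mem_head _ _).
apply: IH => //.
- exact: realizes_vertex.
- by rewrite size_rcons size_link // ltnS ltnW.
move=> z zys; have [|zN zx] := hys z; first by rewrite in_cons zys orbT.
rewrite nth_rcons (real_size rs) hi; split=> //.
rewrite mem_rcons in_cons negb_or zx andbT.
by apply: contraNneq yys => <-.
Qed.

(** The order in which [multisets] lists degrees is met by grouping the new
    neighbours by degree. *)
Lemma multisetsP (f : T -> nat) A (ys : seq T) : uniq A -> {subset map f ys <= A} ->
  exists2 zs, perm_eq zs ys & map f zs \in multisets A (size ys).
Proof.
elim: A ys => [|d A IH] ys.
  by case: ys => [|y ys] _ sub; [exists [::]|have := sub (f y) (mem_head _ _)].
move=> /andP[dA uA] sub.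
have [|zs pz mz] := IH [seq y <- ys | f y != d] uA.
  move=> z /mapP[y]; rewrite mem_filter => /andP[yd yys] ->.
  by have := sub (f y) (map_f f yys); rewrite in_cons (negbTE yd).
exists ([seq y <- ys | f y == d] ++ zs).
  apply: perm_trans (_ : perm_eq _ ([seq y <- ys | f y == d] ++ [seq y <- ys | f y != d])) _.
    by rewrite perm_cat2l.
  by apply/permPl; apply: (perm_filterC (fun y => f y == d)).
have sz : size [seq y <- ys | f y == d] + size [seq y <- ys | f y != d] = size ys.
  by rewrite !size_filter count_predC.
rewrite map_cat; apply/flatten_mapP; exists (size [seq y <- ys | f y == d]).
  by rewrite mem_iota /= add0n ltnS -sz leq_addr.
have -> : map f [seq y <- ys | f y == d] = nseq (size [seq y <- ys | f y == d]) d.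
  rewrite -(size_map f); apply/all_pred1P/allP => z /mapP[y].
  by rewrite mem_filter => /andP[/eqP yd _] ->; rewrite /= yd.
by apply: map_f; rewrite -sz addKn.
Qed.

Lemma childrenP A s x i : uniq A -> (forall y, y \in S -> #|nbrs_in e S y| \in A) ->
  realizes s x -> i < size s -> exists s' x', s' \in children A s i /\ realizes s' x'.
Proof.
move=> uA degA rs hi.
have [|s1 [s1in rs1 sz1 _ nb1]] := splitsP (js := iota 0 (size s)) rs hi.
  by move=> j; rewrite mem_iota.
have hi1 : i < size s1 by rewrite sz1.
pose rest := enum (nbrs_in e S (nth x0 x i) :\: [set y in map (nth x0 x) (nbs_of s1 i)]).
have restP y : y \in rest -> y \in nbrs_in e S (nth x0 x i) /\ y \notin x.
  rewrite mem_enum inE => /andP[nk yN]; split=> //; apply: contra nk => yx.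
  rewrite inE; move: yN; rewrite inE => /andP[_ ey].
  rewrite -(nth_index x0 yx); apply: map_f; apply: nb1; last by rewrite nth_index.
  by rewrite mem_iota /= add0n -(real_size rs) index_mem.
have [|zs pz mz] := multisetsP (f := fun y => #|nbrs_in e S y|) (ys := rest) uA.
  by move=> _ /mapP[y /restP[yN _] ->]; apply: degA; move: yN; rewrite inE => /andP[].
exists (add_vertices s1 i [seq #|nbrs_in e S y| | y <- zs]), (x ++ zs); split.
  apply/flatten_mapP; exists s1 => //; apply: map_f.
  suff <- : size rest = deg_of s1 i - size (nbs_of s1 i) by [].
  rewrite -cardE cardsD (setIidPr (known_sub rs1 hi1)) card_known //.
  by rewrite (real_deg rs1).
apply: realizes_vertices => //.
  by rewrite (perm_uniq pz) enum_uniq.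
by move=> y; rewrite (perm_mem pz); apply: restP.
Qed.

(** A successful search contradicts irreducibility: following the branches
    that hold in the graph ends in a state where a reducible D is exhibited. *)
Lemma check_sound A n s x : irreducible -> uniq A ->
  (forall y, y \in S -> #|nbrs_in e S y| \in A) -> realizes s x -> ~~ check A n s.
Proof.
move=> irr uA degA; elim: n s x => [|n IH] s x rs; apply/negP => /=.
all: have nored : exists_lazy (reducible s) (candidates s) = false.
all: try by elim: candidates => //= D Ds ->; case: ifP => // /(reducibleP rs irr).
all: rewrite nored //; case: ifP => // hi /allP all_c.
have [s' [x' [/all_c c rs']]] := childrenP uA degA rs hi.
by have := IH s' x' rs'; rewrite c.
Qed.

End Soundness.

(** * Dissociation sets in triangle-free graphs *)

Lemma deg0_reducible : check [:: 0; 1; 2; 3; 4] 0 [:: (0, [::])].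
Proof. by vm_compute. Qed.

Lemma deg1_reducible : check [:: 1; 2; 3; 4] 1 [:: (1, [::])].
Proof. by vm_compute. Qed.

Section Bound.
Variables (T : finType) (e : rel T).
Hypotheses (e_sym : symmetric e) (e_irr : irreflexive e) (e_K3_free : K3_free e).
Notation N := (nbrs_in e).
Notation degsum := (degsum e).
Notation dissociation := (dissociation e).
Implicit Types (A B C D R S : {set T}) (x y : T).

Lemma card_nbrs_in A x : #|N A x| = \sum_(y in A) e x y.
Proof.
rewrite -sum1_card (eq_bigl (fun y => (y \in A) && e x y)); last by move=> y; rewrite inE.
by rewrite big_mkcondr; apply: eq_bigr => y _; case: (e x y).
Qed.

Lemma degsumC A B : degsum A B = degsum B A.
Proof.
rewrite /degsum (eq_bigr _ (fun x _ => card_nbrs_in B x)) exchange_big /=.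
by apply: eq_bigr => y _; rewrite card_nbrs_in; apply: eq_bigr => x _; rewrite e_sym.
Qed.

Lemma degsumUl A B C : [disjoint A & B] -> degsum (A :|: B) C = degsum A C + degsum B C.
Proof. by move=> dis; rewrite /degsum -bigU //=; apply: eq_bigl => x; rewrite !inE. Qed.

Lemma degsumUr A B C : [disjoint A & B] -> degsum C (A :|: B) = degsum C A + degsum C B.
Proof. by move=> dis; rewrite !(degsumC C) degsumUl. Qed.

(** Twice the number of edges of S meeting R is counted in two ways. *)
Lemma degsum_remove R S : R \subset S ->
  degsum S S + degsum R R = degsum (S :\: R) (S :\: R) + 2 * degsum R S.
Proof.
move=> RS; have dis : [disjoint R & S :\: R] by rewrite disjoints_subset setCD subsetUr.
have SE : S = R :|: (S :\: R) by rewrite -{1}(setID S R) (setIidPr RS).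
rewrite {1 2 5}SE !degsumUl // !degsumUr // (degsumC (S :\: R) R); lia.
Qed.

Lemma degsum1 x B : degsum [set x] B = #|N B x|.
Proof. by rewrite /degsum big_set1. Qed.

Lemma nbrs1 x : N [set x] x = set0.
Proof. by apply/setP => y; rewrite !inE; case: eqP => // ->; rewrite e_irr. Qed.

Lemma dissociationU D D' R S : D \subset R -> D' \subset S :\: R -> R \subset S ->
  (forall x, x \in D -> N S x \subset R) ->
  dissociation D -> dissociation D' -> dissociation (D :|: D').
Proof.
move=> DR DR' RS closed dD dD' x; rewrite inE => /orP[xD|xD'].
  apply: leq_trans (dD x xD); apply: subset_leq_card; apply/subsetP => y.
  rewrite !inE => /andP[/orP[->//|yD'] exy].
  have := subsetP DR' y yD'; rewrite inE => /andP[yR yS]; case/negP: yR.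
  by apply: (subsetP (closed x xD)); rewrite inE yS exy.
apply: leq_trans (dD' x xD'); apply: subset_leq_card; apply/subsetP => y.
rewrite !inE => /andP[/orP[yD|->//] exy].
have := subsetP DR' x xD'; rewrite inE => /andP[xR xS]; case/negP: xR.
by apply: (subsetP (closed y yD)); rewrite inE xS e_sym.
Qed.

Definition good S := exists D : {set T},
  [/\ D \subset S, dissociation D & 242 * #|S| <= 384 * #|D| + 25 * degsum S S].

Lemma not_good_irreducible S : (forall S', #|S'| < #|S| -> good S') -> ~ good S ->
  irreducible e S.
Proof.
move=> IH bad D R RS DR R0 closed dD; rewrite ltnNge; apply/negP => le; apply: bad.
have RS0 := cardsD S R; rewrite (setIidPr RS) in RS0.
have cRS := subset_leq_card RS; rewrite -card_gt0 in R0.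
have [|D' [DS' dD' le']] := IH (S :\: R); first by lia.
exists (D :|: D'); split.
- rewrite subUset (subset_trans DR RS); apply: subset_trans DS' _; exact: subsetDl.
- exact: dissociationU DR DS' RS closed dD dD'.
have dis : [disjoint D & D'].
  rewrite disjoint_subset; apply/subsetP => x /(subsetP DR) xR; rewrite !inE.
  by apply/negP => /(subsetP DS'); rewrite inE xR.
have := cardsU D D'; rewrite (eqP (_ : D :&: D' == set0)) ?setI_eq0 // cards0 => ->.
have := degsum_remove RS; lia.
Qed.

(** Moving a vertex to the other side of a cut with fewest inner edges cannot
    lower the number of inner edges. *)
Lemma max_cut S : exists2 A : {set T}, A \subset S & forall x,
  (x \in A -> #|N A x| <= #|N (S :\: A) x|) /\ (x \in S :\: A -> #|N (S :\: A) x| <= #|N A x|).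
Proof.
pose f A := degsum A A + degsum (S :\: A) (S :\: A).
case: (@arg_minnP _ S (fun A : {set T} => A \subset S) f (subxx S)) => A AS minA.
exists A => // x.
have move_in (B C : {set T}) : x \in B -> x \notin C ->
    degsum (B :\ x) (B :\ x) + degsum (x |: C) (x |: C) + 2 * #|N B x| =
    degsum B B + degsum C C + 2 * #|N C x|.
  move=> xB xC.
  have := @degsum_remove [set x] B; rewrite sub1set => /(_ xB).
  have := @degsum_remove [set x] (x |: C); rewrite sub1set setU11 => /(_ isT).
  rewrite setU1K // !degsum1 nbrs1 cards0.
  have -> : N (x |: C) x = N C x.
    by apply/setP => y; rewrite !inE; case: eqVneq => // ->; rewrite e_irr /= andbF.
  lia.
split=> [xA|xC].
  have xC : x \notin S :\: A by rewrite inE xA.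
  have := move_in A (S :\: A) xA xC.
  have := minA (A :\ x) (subset_trans (subsetDl _ _) AS); rewrite /f.
  have -> : S :\: (A :\ x) = x |: (S :\: A).
    rewrite setDDr setUC; congr (_ :|: _); apply/setIidPr.
    by rewrite sub1set (subsetP AS).
  lia.
have /andP[xA xS] : (x \notin A) && (x \in S) by move: xC; rewrite inE.
have := move_in (S :\: A) A xC xA.
have := minA (x |: A); rewrite subUset sub1set xS AS => /(_ isT); rewrite /f.
have -> : S :\: (x |: A) = (S :\: A) :\ x by rewrite setDDl setUC.
lia.
Qed.

(** In a maximum cut each vertex has at most half of its at most three
    neighbours, hence at most one, on its own side. *)
Lemma cubic_half S : (forall x, x \in S -> #|N S x| <= 3) ->
  exists D : {set T}, [/\ D \subset S, dissociation D & #|S| <= 2 * #|D|].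
Proof.
move=> deg3; have [A AS cut] := max_cut S.
have dis : [disjoint A & S :\: A] by rewrite disjoints_subset setCD subsetUr.
have split x : #|N S x| = #|N A x| + #|N (S :\: A) x|.
  have SE : S = A :|: (S :\: A) by rewrite -{1}(setID S A) (setIidPr AS).
  by rewrite -!degsum1 {1}SE degsumUr.
have dA : dissociation A.
  move=> x xA; have [/(_ xA) h _] := cut x; have := deg3 x (subsetP AS x xA).
  by rewrite split; lia.
have dC : dissociation (S :\: A).
  move=> x xC; have [_ /(_ xC) h] := cut x; have := deg3 x (subsetP (subsetDl S A) x xC).
  by rewrite split; lia.
have := cardsD S A; rewrite (setIidPr AS); have := subset_leq_card AS => h1 h2.
have [h|h] := leqP #|S| (2 * #|A|); first by exists A.
by exists (S :\: A); split; rewrite ?subsetDl //; lia.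
Qed.

Lemma realizes_vertex1 S x : x \in S -> realizes e S x [:: (#|N S x|, [::])] [:: x].
Proof.
move=> xS; split=> //.
- by move=> y; rewrite inE => /eqP ->.
- by case.
- by case.
- by case.
Qed.

Lemma realizes_edge34 S x y : x \in S -> y \in S -> e x y -> #|N S x| = 3 -> #|N S y| = 4 ->
  realizes e S x root34 [:: x; y].
Proof.
move=> xS yS exy dx dy; split=> //.
- by rewrite /= inE andbT; apply: contraTneq exy => ->; rewrite e_irr.
- by move=> z; rewrite !inE => /orP[]/eqP ->.
- by do 2 case=> //.
- by do 2 case=> //.
- case=> [|[|//]] j _; rewrite inE => /eqP -> /=; split=> //.
  by rewrite e_sym.
Qed.

Hypothesis no_4regular : forall S, S != set0 -> exists2 x, x \in S & #|N S x| != 4.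

(** The degrees of a minimal counterexample are excluded one after the other:
    those above 4 by deleting a single vertex, 0, 1, 2 and the adjacent pair 3, 4
    by the search, 4 by hypothesis and 3 by [cubic_half]. *)
Lemma dissociation_bound S : good S.
Proof.
have [n] := ubnP #|S|; elim: n S => // n IH S leS.
have {}IH S' : #|S'| < #|S| -> good S' by move=> h; apply: IH; lia.
have [->|S0] := eqVneq S set0.
  exists set0; split; rewrite ?subxx //; last by rewrite cards0 muln0.
  by move=> x; rewrite inE.
apply: boolp.contrapT => bad; have irr := not_good_irreducible IH bad.
have sound (A : seq nat) n' s xs x0 := @check_sound T e S x0 e_sym e_irr e_K3_free A n' s xs irr.
have deg4 x : x \in S -> #|N S x| <= 4.
  move=> xS; have := irr set0 [set x]; rewrite sub1set xS sub0set -card_gt0 cards1 cards0.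
  rewrite !degsum1 nbrs1 cards0 => H; have := H isT isT isT _ _.
  suff h : 384 * 0 + 50 * #|N S x| < 242 * 1 + 25 * 0 by lia.
  by apply: H => // y; rewrite inE.
have degA x : x \in S -> #|N S x| \in [:: 0; 1; 2; 3; 4].
  by move/deg4; rewrite !inE; lia.
have deg1 x : x \in S -> 1 <= #|N S x|.
  move=> xS; rewrite lt0n; apply/eqP => d0.
  have := sound [:: 0; 1; 2; 3; 4] 0 _ _ x isT degA (realizes_vertex1 xS).
  by rewrite d0 deg0_reducible.
have degA' x : x \in S -> #|N S x| \in [:: 1; 2; 3; 4].
  by move=> xS; have := degA x xS; have := deg1 x xS; rewrite !inE; lia.
have deg2 x : x \in S -> 2 <= #|N S x|.
  move=> xS; rewrite leqNgt; apply/negP => lt2.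
  have d1 : #|N S x| = 1 by have := deg1 x xS; lia.
  have := sound [:: 1; 2; 3; 4] 1 _ _ x isT degA' (realizes_vertex1 xS).
  by rewrite d1 deg1_reducible.
have degB x : x \in S -> #|N S x| \in [:: 2; 3; 4].
  by move=> xS; have := degA x xS; have := deg2 x xS; rewrite !inE; lia.
have deg3 x : x \in S -> 3 <= #|N S x|.
  move=> xS; rewrite leqNgt; apply/negP => lt3.
  have d2 : #|N S x| = 2 by have := deg2 x xS; lia.
  have := sound [:: 2; 3; 4] 7 _ _ x isT degB (realizes_vertex1 xS).
  by rewrite d2 deg2_reducible.
have degC x : x \in S -> #|N S x| \in [:: 3; 4].
  by move=> xS; have := degB x xS; have := deg3 x xS; rewrite !inE; lia.
have no34 x y : x \in S -> y \in S -> e x y -> #|N S x| = 3 -> #|N S y| = 4 -> False.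
  move=> xS yS exy dx dy.
  have := sound [:: 3; 4] 8 _ _ x isT degC (realizes_edge34 xS yS exy dx dy).
  by rewrite edge34_reducible.
pose S4 := [set x in S | #|N S x| == 4].
have [S40|S40] := eqVneq S4 set0; last first.
  have [x xS4 /negP[]] := no_4regular S40.
  have [xS /eqP dx] : x \in S /\ #|N S x| == 4 by move: xS4; rewrite inE => /andP.
  rewrite -dx; apply/eqP; congr #|pred_of_set _|; apply/setP => y; rewrite !inE.
  case yS: (y \in S) => //=; case exy: (e x y); rewrite ?andbF // andbT.
  have := degC y yS; rewrite !inE => /orP[/eqP dy|->//].
  by exfalso; apply: (no34 y x) => //; rewrite e_sym.
apply: bad; have cubic x : x \in S -> #|N S x| = 3.
  move=> xS; have := degC x xS; rewrite !inE => /orP[/eqP//|d4].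
  by have : x \in S4; [rewrite inE xS|rewrite S40 inE].
have [|D [DS dD h]] := @cubic_half S; first by move=> x /cubic ->.
exists D; split=> //.
rewrite /degsum (eq_bigr _ cubic) sum_nat_const; lia.
Qed.

End Bound.

Local Open Scope ring_scope.

(** * Parity of crossings between segments *)

Section Segments.
Variable R : realFieldType.
Implicit Types a b p q z : R * R.

Definition in_seg a b z : Prop := exists2 t : R, 0 <= t <= 1 &
  z = (a.1 + t * (b.1 - a.1), a.2 + t * (b.2 - a.2)).

Definition seg_disj a b p q : Prop := forall z, in_seg a b z -> in_seg p q z -> False.

Definition height a b (x : R) : R := a.2 + (b.2 - a.2) * ((x - a.1) / (b.1 - a.1)).

(** Whether the upward vertical ray from [p] meets the segment [a b].  The
    large inequality makes the projection of the segment half-open, so that a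
    ray through a common end of two consecutive segments is counted
    consistently; it amounts to moving [p] infinitesimally to the right. *)
Definition upcross p a b : bool :=
  ((a.1 <= p.1) != (b.1 <= p.1)) && (p.2 < height a b p.1).

(** The dual count: the downward ray from [a] against [p q].  Its inequalities
    are strict because it is now the segment that is moved infinitesimally to
    the right. *)
Definition downcross a p q : bool :=
  ((p.1 < a.1) != (q.1 < a.1)) && (height p q a.1 < a.2).

Lemma in_seg_sym a b z : in_seg a b z -> in_seg b a z.
Proof.
move=> [t t01 ->]; exists (1 - t); first by lra.
by congr pair; ring.
Qed.

Lemma seg_disj_symr a b p q : seg_disj a b p q -> seg_disj a b q p.
Proof. by move=> dis z /dis zP /in_seg_sym. Qed.

Lemma seg_disj_sym a b p q : seg_disj a b p q -> seg_disj p q a b.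
Proof. by move=> dis z z1 z2; apply: (dis z). Qed.

Lemma height_sym a b x : a.1 != b.1 -> height a b x = height b a x.
Proof.
move=> ab; rewrite /height; field.
by rewrite !subr_eq0 ab eq_sym.
Qed.

Lemma upcross_sym p a b : upcross p a b = upcross p b a.
Proof.
rewrite /upcross eq_sym; case: eqVneq => //= ne; rewrite height_sym //.
by apply: contraNneq ne => ->.
Qed.

Lemma downcross_sym a p q : downcross a p q = downcross a q p.
Proof.
rewrite /downcross eq_sym; case: eqVneq => //= ne; rewrite height_sym //.
by apply: contraNneq ne => ->.
Qed.

Lemma height_l a b : height a b a.1 = a.2.
Proof. by rewrite /height subrr mul0r mulr0 addr0. Qed.

Lemma height_r a b : a.1 != b.1 -> height a b b.1 = b.2.
Proof. by move=> ab; rewrite height_sym // height_l. Qed.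

Lemma in_seg_height a b x : a.1 < b.1 -> a.1 <= x <= b.1 -> in_seg a b (x, height a b x).
Proof.
move=> ab /andP[ax xb]; exists ((x - a.1) / (b.1 - a.1)).
  by rewrite divr_ge0 ?subr_ge0 ?(ltW ab)//= ler_pdivrMr ?subr_gt0// mul1r lerD2r.
congr pair; last by rewrite /height mulrC.
by field; rewrite subr_eq0 gt_eqF.
Qed.

Lemma in_seg_vert a b y : a.1 = b.1 -> a.2 <= y <= b.2 -> in_seg a b (a.1, y).
Proof.
move=> ab /andP[ay yb].
have [e|ne] := eqVneq a.2 b.2.
  exists 0; first by rewrite lexx ler01.
  by rewrite !mul0r !addr0; congr pair; lra.
exists ((y - a.2) / (b.2 - a.2)).
  have ab2 : a.2 < b.2 by rewrite lt_neqAle ne; lra.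
  by rewrite divr_ge0 ?subr_ge0 ?(ltW ab2)//= ler_pdivrMr ?subr_gt0// mul1r lerD2r.
congr pair; first by rewrite ab subrr mulr0 addr0.
by field; rewrite subr_eq0 eq_sym.
Qed.

Lemma height_affine a b x y t :
  height a b (x + t * (y - x)) = height a b x + t * (height a b y - height a b x).
Proof. by rewrite /height; set k := (_ - _)^-1; ring. Qed.

(** Over a common range of abscissas the difference of the two heights is
    affine; a sign change would give a common point. *)
Lemma no_crossing a b p q x1 x2 : a.1 < b.1 -> p.1 < q.1 -> seg_disj a b p q ->
  a.1 <= x1 <= b.1 -> p.1 <= x1 <= q.1 -> a.1 <= x2 <= b.1 -> p.1 <= x2 <= q.1 ->
  height p q x1 < height a b x1 -> height p q x2 < height a b x2.
Proof.
move=> ab pq dis h1 h2 h3 h4 lt1; rewrite ltNge; apply/negP => le2.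
set h := fun x => height a b x - height p q x.
have h1p : 0 < h x1 by rewrite /h; lra.
have h2n : h x2 <= 0 by rewrite /h; lra.
pose t := h x1 / (h x1 - h x2).
have hd : 0 < h x1 - h x2 by lra.
have t0 : 0 <= t by rewrite divr_ge0 // ltW.
have t1 : t <= 1 by rewrite ler_pdivrMr // mul1r; lra.
pose x := x1 + t * (x2 - x1).
have xE : height a b x = height p q x.
  apply/eqP; rewrite -subr_eq0 /x !height_affine.
  suff : h x1 - t * (h x1 - h x2) = 0 by rewrite /h => e; apply/eqP; rewrite -e; ring.
  by rewrite /t mulfVK ?subrr // gt_eqF.
have xab u v : u <= x1 <= v -> u <= x2 <= v -> u <= x <= v.
  move=> /andP[? ?] /andP[? ?]; rewrite /x; apply/andP; split; nra.
by apply: (dis (x, height a b x)); [|rewrite xE]; apply: in_seg_height => //; apply: xab.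
Qed.

Lemma no_crossing_eq a b p q x1 x2 : a.1 < b.1 -> p.1 < q.1 -> seg_disj a b p q ->
  a.1 <= x1 <= b.1 -> p.1 <= x1 <= q.1 -> a.1 <= x2 <= b.1 -> p.1 <= x2 <= q.1 ->
  (height p q x1 < height a b x1) = (height p q x2 < height a b x2).
Proof.
by move=> *; apply/idP/idP; apply: no_crossing.
Qed.

(** Over the common projection of the two segments none changes its position
    with respect to the other.  With the half-open conventions each of the two
    ends of this projection is the abscissa of exactly one of the four points;
    the terms of these two points agree and the others vanish. *)
Lemma parity4 a b p q : seg_disj a b p q ->
  upcross p a b (+) upcross q a b = downcross a p q (+) downcross b p q.
Proof.
wlog ab : a b / a.1 <= b.1 => [hw|].
  move=> dis; case: (leP a.1 b.1) => [le|/ltW le]; first exact: hw.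
  rewrite (upcross_sym p) (upcross_sym q) addbC [RHS]addbC -hw // 1?addbC //.
  by move=> z /in_seg_sym; apply: dis.
wlog pq : p q / p.1 <= q.1 => [hw|dis].
  move=> dis; case: (leP p.1 q.1) => [le|/ltW le]; first exact: hw.
  rewrite addbC (downcross_sym a) (downcross_sym b) hw //; exact: seg_disj_symr.
rewrite /upcross /downcross.
have E (x y z : R) : x <= y -> ((x <= z) != (y <= z)) = (x <= z < y).
  by move=> xy; case: (leP x z) => xz; case: (leP y z) => yz //; lra.
have E' (x y z : R) : x <= y -> ((x < z) != (y < z)) = (x < z <= y).
  by move=> xy; case: (ltP x z) => xz; case: (ltP y z) => yz //; lra.
rewrite !E // !E' //.
case: (leP a.1 p.1) => ap; case: (ltP q.1 b.1) => qb /=.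
- have -> : p.1 < b.1 by lra.
  have -> : a.1 <= q.1 by lra.
  have abl : a.1 < b.1 by lra.
  rewrite /=; have [e|ne] := eqVneq p.1 q.1.
    rewrite -e; case: ltP => h1; case: ltP => h2 //.
      exfalso; apply: (dis (p.1, height a b p.1)); first by apply: in_seg_height => //; lra.
      by apply: in_seg_vert => //; rewrite (ltW h1).
    exfalso; apply: (dis (q.1, height a b p.1)); first by rewrite -e; apply: in_seg_height => //; lra.
    by apply/in_seg_sym/in_seg_vert => //; rewrite (ltW h2).
  have pql : p.1 < q.1 by rewrite lt_neqAle ne.
  rewrite -(@height_l p q) -(@height_r p q) //.
  by rewrite (no_crossing_eq (x1 := p.1) (x2 := q.1) _ _ dis) ?addbb //; lra.
- rewrite andbF /= andbT addbF.
  case: (ltP p.1 b.1) => pb //=.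
  have abl : a.1 < b.1 by lra.
  have pql : p.1 < q.1 by lra.
  rewrite -(@height_l p q) -(@height_r a b) ?lt_eqF //.
  by apply: (no_crossing_eq _ _ dis) => //; lra.
- rewrite andbF /= andbT addbF.
  case: (leP a.1 q.1) => aq //=.
  have abl : a.1 < b.1 by lra.
  have pql : p.1 < q.1 by lra.
  rewrite -(@height_r p q) ?lt_eqF // -(@height_l a b).
  by apply: (no_crossing_eq _ _ dis) => //; lra.
- have -> : p.1 < b.1 by lra.
  have -> : a.1 <= q.1 by lra.
  have pql : p.1 < q.1 by lra.
  rewrite /=; have [e|ne] := eqVneq a.1 b.1.
    rewrite -e; case: ltP => h1; case: ltP => h2 //.
      exfalso; apply: (dis (b.1, height p q a.1)).
        by apply/in_seg_sym/in_seg_vert => //; rewrite h2 ltW.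
      by rewrite -e; apply: in_seg_height => //; lra.
    exfalso; apply: (dis (a.1, height p q a.1)).
      by apply/in_seg_vert => //; rewrite h1 ltW.
    by apply: in_seg_height => //; lra.
  have abl : a.1 < b.1 by rewrite lt_neqAle ne.
  rewrite -(@height_l a b) -(@height_r a b) //.
  by rewrite (no_crossing_eq (x1 := a.1) (x2 := b.1) _ _ dis) ?addbb //; lra.
Qed.

End Segments.

(** * Winding parities as linear forms on even edge sets *)

Lemma addb_eqF b c : b (+) c = false -> b = c.
Proof. by case: b c => [] []. Qed.

Section EvenSets.
Variables (V I : finType) (endv : I -> bool -> V).

Definition evenset (z : {set I}) : bool :=
  [forall u, ~~ \big[addb/false]_(i in z) ((endv i false == u) (+) (endv i true == u))].

Lemma evenset_sum (z : {set I}) (h : V -> bool) : evenset z ->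
  \big[addb/false]_(i in z) (h (endv i false) (+) h (endv i true)) = false.
Proof.
move=> /forallP ev.
transitivity (\big[addb/false]_u \big[addb/false]_(i in z)
   (h u && ((endv i false == u) (+) (endv i true == u)))).
  rewrite exchange_big /=; apply: eq_bigr => i _.
  have E v : \big[addb/false]_u (h u && (v == u)) = h v.
    rewrite (bigD1 v) //= eqxx andbT big1 ?addbF // => u ne.
    by rewrite eq_sym (negbTE ne) andbF.
  rewrite -(E (endv i false)) -(E (endv i true)) -big_split /=.
  by apply: eq_bigr => u _; rewrite andb_addr.
apply: big1 => u _; rewrite -(big_distrr (h u)) /=.
by rewrite (negbTE (ev u)) andbF.
Qed.

(** Forms on the cycle space are represented by functions that vanish outside
    the even sets, so that equality of forms is equality of functions. *)
Definition edge_form (i : I) : {ffun {set I} -> bool} := [ffun z => evenset z && (i \in z)].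

Definition xor_ffun (f g : {ffun {set I} -> bool}) : {ffun {set I} -> bool} :=
  [ffun z => f z (+) g z].

(** [f] and [g] may be the forms of two points next to the edge [i], on the
    same side of it or on different sides. *)
Definition same_sides i f g := g = f \/ g = xor_ffun f (edge_form i).

Lemma xor_ffunK f g : xor_ffun (xor_ffun f g) g = f.
Proof. by apply/ffunP => z; rewrite !ffunE addbK. Qed.

Lemma same_sides_trans i f g h : same_sides i f g -> same_sides i g h -> same_sides i f h.
Proof.
by move=> [->|->] [->|->]; rewrite ?xor_ffunK; [left|right|right|left].
Qed.

End EvenSets.

Section Parity.
Variables (R : realFieldType) (V I : finType) (endv : I -> bool -> V).
Variables (pos : V -> R * R) (rad : I -> bool -> R * R) (inner : I -> seq (R * R)).
Hypothesis inner_last : forall i, last (rad i false) (inner i) = rad i true.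
Implicit Types p q : R * R.

Definition chain (x : R * R) (l : seq (R * R)) := zip (x :: l) l.

Definition inner_segs i := chain (rad i false) (inner i).

Definition upcrosses p (l : seq ((R * R) * (R * R))) :=
  \big[addb/false]_(ab <- l) upcross p ab.1 ab.2.

(** The drawing of an edge consists of a straight piece at each end, from the
    vertex [pos] to the point [rad], and of the polygonal line [inner] from
    [rad i false] to [rad i true]. *)
Definition crossings p i :=
  upcrosses p (inner_segs i) (+) (upcross p (pos (endv i false)) (rad i false) (+)
    upcross p (pos (endv i true)) (rad i true)).

Definition avoids i p q : Prop :=
  (forall b, seg_disj (pos (endv i b)) (rad i b) p q) /\
  (forall ab, ab \in inner_segs i -> seg_disj ab.1 ab.2 p q).

Lemma upcrosses_chain x l p q : (forall ab, ab \in chain x l -> seg_disj ab.1 ab.2 p q) ->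
  upcrosses p (chain x l) (+) upcrosses q (chain x l) = downcross x p q (+) downcross (last x l) p q.
Proof.
rewrite /chain; elim: l x => [|y l IH] x dis /=.
  by rewrite /upcrosses !big_nil !addbb.
rewrite /upcrosses !big_cons /= addbACA IH; last first.
  by move=> ab h; apply: dis; rewrite in_cons h orbT.
rewrite (parity4 (dis (x, y) _)) ?mem_head //.
by rewrite -addbA (addbA (downcross y p q)) addbb.
Qed.

(** The contributions of the inner corners cancel, which leaves only the two
    ends of the edge. *)
Lemma crossings_move i p q : avoids i p q ->
  crossings p i (+) crossings q i =
  downcross (pos (endv i false)) p q (+) downcross (pos (endv i true)) p q.
Proof.
move=> [rd /upcrosses_chain]; rewrite inner_last /crossings addbACA => ->.
rewrite [X in _ (+) X]addbACA !(parity4 (rd _)).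
by do 4 case: (downcross _ p q).
Qed.

Definition winding p : {ffun {set I} -> bool} :=
  [ffun z => evenset endv z && \big[addb/false]_(i in z) crossings p i].

(** Summed over an even set, the two end contributions of each edge cancel at
    every vertex. *)
Lemma winding_eq p q : (forall i, avoids i p q) -> winding p = winding q.
Proof.
move=> av; apply/ffunP => z; rewrite !ffunE; case: (boolP (evenset endv z)) => //= ev.
apply: addb_eqF; rewrite -big_split /=.
rewrite (eq_bigr _ (fun i _ => crossings_move (av i))).
exact: (evenset_sum (fun v => downcross (pos v) p q) ev).
Qed.

(** Only the edge [i] may contribute to the change, and it does so by the same
    bit for all the even sets that contain it. *)
Lemma winding_near i p q : (forall j, j != i -> avoids j p q) -> same_sides endv i (winding p) (winding q).
Proof.
move=> av.
pose k := crossings p i (+) crossings q i (+)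
   (downcross (pos (endv i false)) p q (+) downcross (pos (endv i true)) p q).
have E z : winding q z = winding p z (+) (k && edge_form endv i z).
  rewrite !ffunE; case: (boolP (evenset endv z)) => //= ev; last by rewrite andbF.
  have := evenset_sum (fun v => downcross (pos v) p q) ev.
  have [iz|iz] := boolP (i \in z); last first.
    rewrite andbF addbF => e0.
    apply: addb_eqF; rewrite -big_split -[RHS]e0 /=.
    apply: eq_bigr => j jz; rewrite addbC crossings_move //; apply: av.
    by apply: contraNneq iz => <-.
  rewrite andbT (bigD1 i) //= => e0.
  rewrite (bigD1 i) //= [X in _ = X (+) _](bigD1 i) //= /k.
  have E0 : \big[addb/false]_(j in z | j != i)
      (downcross (pos (endv j false)) p q (+) downcross (pos (endv j true)) p q) =
    \big[addb/false]_(j in z | j != i) crossings p j (+)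
    \big[addb/false]_(j in z | j != i) crossings q j.
    rewrite -big_split /=; apply: eq_bigr => j /andP[_ ne].
    by rewrite crossings_move //; apply: av.
  move: e0; rewrite E0.
  move: (\big[_/_]_(_ in _ | _) crossings p _) => A.
  move: (\big[_/_]_(_ in _ | _) crossings q _) => B.
  case: (crossings p i); case: (crossings q i); case: A; case: B;
  by case: (downcross (pos (endv i false)) p q); case: (downcross (pos (endv i true)) p q).
case: k E => E; [right|left]; apply/ffunP => z; rewrite E ?ffunE //= ?addbF //.
Qed.

(** For [p] vertically below [q] no vertex lies over the segment [p q], so the
    single crossing with the end piece of [i] is the only change. *)
Lemma winding_cross i b p q :
  (forall j, j != i -> avoids j p q) ->
  p.1 = q.1 ->
  (forall ab, ab \in inner_segs i -> seg_disj ab.1 ab.2 p q) ->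
  seg_disj (pos (endv i (~~ b))) (rad i (~~ b)) p q ->
  ~~ upcross q (pos (endv i b)) (rad i b) -> upcross p (pos (endv i b)) (rad i b) ->
  winding q = xor_ffun (winding p) (edge_form endv i).
Proof.
move=> av pq dis1 dis2 cq cp; apply/ffunP => z.
rewrite !ffunE; case: (boolP (evenset endv z)) => //= ev.
have crd0 a : downcross a p q = false by rewrite /downcross pq eqxx.
have same j : avoids j p q -> crossings p j = crossings q j.
  by move=> /crossings_move; rewrite !crd0; do 2 case: crossings.
have ci : crossings q i = ~~ crossings p i.
  have /addb_eqF e1 : upcrosses p (inner_segs i) (+) upcrosses q (inner_segs i) = false.
    by rewrite (upcrosses_chain dis1) !crd0.
  have := parity4 dis2; rewrite !crd0 => /addb_eqF.
  rewrite /crossings e1; case: b cq cp {dis2} => /negbTE -> -> ->;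
  by case: (upcrosses _ _); case: (upcross _ _ _).
have [iz|iz] := boolP (i \in z); last first.
  rewrite addbF; apply: eq_bigr => j jz; apply/esym/same/av.
  by apply: contraNneq iz => <-.
rewrite addbT (bigD1 i) //= ci [in RHS](bigD1 i) //= addNb; congr (~~ (_ (+) _)).
by apply: eq_bigr => j /andP[_ ne]; apply/esym/same/av.
Qed.

Lemma winding_near_chain i x l :
  (forall j ab, j != i -> ab \in chain x l -> avoids j ab.1 ab.2) ->
  same_sides endv i (winding x) (winding (last x l)).
Proof.
rewrite /chain; elim: l x => [|y l IH] x av /=; first by left.
apply: (@same_sides_trans _ _ _ _ _ (winding y)).
  by apply: winding_near => j ne; apply: (av j (x, y)) => //; rewrite mem_head.
by apply: IH => j ab ne h; apply: av => //; rewrite in_cons h orbT.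
Qed.

End Parity.

(** * Small constants and points on a vertical line *)

Section Small.
Variable R : realFieldType.

Lemma seq_small (J : eqType) (s : seq J) (P : J -> R -> Prop) :
  (forall x d e, 0 < d <= e -> P x e -> P x d) ->
  (forall x, x \in s -> exists2 e : R, 0 < e & P x e) ->
  exists2 e : R, 0 < e & forall x, x \in s -> P x e.
Proof.
move=> Pd; elim: s => [|x s IH] ex; first by exists 1.
have [|e e0 Pe] := IH; first by move=> y ys; apply: ex; rewrite in_cons ys orbT.
have [d d0 dP] := ex x (mem_head _ _).
exists (Num.min d e) => [|y]; first by rewrite lt_min d0.
rewrite in_cons => /predU1P[->|ys].
  by apply: Pd dP; rewrite lt_min d0 e0 ge_min lexx.
by apply: Pd (Pe _ ys); rewrite lt_min d0 e0 ge_min lexx orbT.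
Qed.

Lemma fin_small (J : finType) (P : J -> R -> Prop) :
  (forall x d e, 0 < d <= e -> P x e -> P x d) ->
  (forall x, exists2 e : R, 0 < e & P x e) ->
  exists2 e : R, 0 < e & forall x, P x e.
Proof.
move=> Pd ex; have [|e e0 eP] := @seq_small _ (enum J) P Pd; first by move=> x _; apply: ex.
by exists e => // x; apply: eP; rewrite mem_enum.
Qed.

(** [W] is constant between consecutive points of [s], so the values on the
    right of one point and on the left of the next one cancel. *)
Lemma line_parity (A : eqType) (W : R -> A) (s : seq R) (d lo hi : R) (f : A) :
  0 < d -> uniq s -> lo <= hi ->
  {in s &, forall x y, x < y -> x + 2 * d < y} ->
  {in s, forall x, lo < x - d /\ x + d < hi} ->
  (forall y z, lo <= y -> y <= z -> z <= hi -> (forall x, x \in s -> ~~ (y <= x <= z)) ->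
     W y = W z) ->
  \big[addb/false]_(x <- s) ((W (x - d) == f) (+) (W (x + d) == f)) =
  (W lo == f) (+) (W hi == f).
Proof.
move=> d0 us lohi gap rng const.
rewrite -(perm_big _ (permEl (perm_sort <=%O s))) /=.
have ps : perm_eq (sort <=%O s) s by apply/permEl/perm_sort.
have: sorted <=%O (sort <=%O s) by apply: sort_sorted; apply: le_total.
have: uniq (sort <=%O s) by rewrite sort_uniq.
have {}gap : {in sort <=%O s &, forall x y, x < y -> x + 2 * d < y}.
  by move=> x y; rewrite !mem_sort; apply: gap.
have {}rng : {in sort <=%O s, forall x, lo < x - d /\ x + d < hi}.
  by move=> x; rewrite !mem_sort; apply: rng.
have {}const : forall y z, lo <= y -> y <= z -> z <= hi ->
    (forall x, x \in sort <=%O s -> ~~ (y <= x <= z)) -> W y = W z.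
  by move=> y z ly yz zh h; apply: const => // x xs; apply: h; rewrite mem_sort.
move: (sort _ s) gap rng const {us ps} => {}s.
elim: s lo lohi => [|x s IH] lo lohi gap rng const /=.
  by move=> _ _; rewrite big_nil (const lo hi) ?addbb.
move=> /andP[xs us] xp.
have [lx xh] := rng x (mem_head _ _).
have xall : {in s, forall y, x < y}.
  move=> y ys; rewrite lt_neqAle; apply/andP; split.
    by apply: contraNneq xs => ->.
  by have /(order_path_min le_trans)/allP/(_ y ys) := xp.
have xgap y : y \in s -> x + 2 * d < y.
  by move=> ys; apply: gap; rewrite ?mem_head ?in_cons ?ys ?orbT //; apply: xall.
rewrite big_cons (IH (x + d)) ?(ltW xh) ?(path_sorted xp) //.
- rewrite (const lo (x - d)) //; [|lra|lra|].
    by rewrite addbA -(addbA (_ == _)) addbb addbF.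
  move=> y; rewrite in_cons => /predU1P[->|/xgap]; lra.
- by move=> y z ys zs; apply: gap; rewrite in_cons ?ys ?zs orbT.
- move=> y ys; have := xgap y ys.
  have [] := rng y; first by rewrite in_cons ys orbT.
  by move=> *; split; lra.
move=> y z xy yz zh h; apply: const => // [|v]; first by lra.
by rewrite in_cons => /predU1P[->|/h //]; lra.
Qed.

Lemma in_seg_between (a b z : R * R) lo hi : in_seg a b z ->
  lo <= a.1 <= hi -> lo <= b.1 <= hi -> lo <= z.1 <= hi.
Proof. by move=> [t t01 ->] /= h1 h2; apply/andP; split; nra. Qed.

End Small.

Local Close Scope ring_scope.

(** * Euler's bound from a family of boundaries *)

Section Girth.
Variables (V I : finType) (endv : I -> bool -> V).
Definition ends i : {set V} := [set endv i false; endv i true].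
Hypothesis loopless : forall i, endv i false != endv i true.
Hypothesis ends_inj : injective ends.
Hypothesis triangle_free : forall a b c i j k,
  ends i = [set a; b] -> ends j = [set b; c] -> ends k = [set a; c] -> False.

Lemma ends_other i a : a \in ends i -> exists2 b, b != a & ends i = [set a; b].
Proof.
have ne := loopless i; rewrite !inE => /orP[]/eqP ->.
  by exists (endv i true); rewrite 1?eq_sym.
by exists (endv i false); rewrite // /ends setUC.
Qed.

Lemma even_next (z : {set I}) i a : evenset endv z -> i \in z -> a \in ends i ->
  exists j b, [/\ j \in z, j != i, b != a & ends j = [set a; b]].
Proof.
move=> /forallP/(_ a) ev iz ai.
have incE j : (endv j false == a) (+) (endv j true == a) = (a \in ends j).
  have ne := loopless j; rewrite !inE ![a == _]eq_sym.
  by case: (eqVneq _ a) => [<-|]; rewrite ?addbF // eq_sym (negbTE ne).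
have [j /andP[/andP[jz ji] aj]|none] := pickP [pred j | (j \in z) && (j != i) && (a \in ends j)].
  by have [b ba E] := ends_other aj; exists j, b.
move: ev; rewrite (bigD1 i) //= incE ai big1 // => j /andP[jz ji].
by rewrite incE; have := none j; rewrite /= jz ji.
Qed.

(** Walking along an even set never stops, and it cannot come back before the
    fourth edge: there are no parallel edges and no triangles. *)
Lemma even_card (z : {set I}) : evenset endv z -> z != set0 -> 4 <= #|z|.
Proof.
move=> ev /set0Pn[i0 i0z].
pose u := endv i0 false; pose v := endv i0 true.
have E0 : ends i0 = [set u; v] by [].
have uv : u != v by apply: loopless.
have [||j1 [w [j1z j10 wv E1]]] := even_next (i := i0) (a := v) ev; rewrite ?E0 ?in_set2 ?eqxx ?orbT //.
have wu : w != u.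
  by apply: contraNneq j10 => wu; apply/eqP/ends_inj; rewrite E1 E0 wu setUC.
have [||j2 [x [j2z j21 xw E2]]] := even_next (i := j1) (a := w) ev; rewrite ?E1 ?in_set2 ?eqxx ?orbT //.
have xv : x != v.
  by apply: contraNneq j21 => xv; apply/eqP/ends_inj; rewrite E1 E2 xv setUC.
have xu : x != u.
  apply/eqP => xu; apply: (triangle_free (a := u) (b := v) (c := w) E0 E1 (k := j2)).
  by rewrite E2 xu setUC.
have [||j3 [y [j3z j32 yx E3]]] := even_next (i := j2) (a := x) ev; rewrite ?E2 ?in_set2 ?eqxx ?orbT //.
have j20 : j2 != i0.
  apply/eqP => e; have : w \in ends i0 by rewrite -e E2 in_set2 eqxx.
  by rewrite E0 in_set2 (negbTE wu) (negbTE wv).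
have j30 : j3 != i0.
  apply/eqP => e; have : x \in ends i0 by rewrite -e E3 in_set2 eqxx.
  by rewrite E0 in_set2 (negbTE xu) (negbTE xv).
have j31 : j3 != j1.
  apply/eqP => e; have : x \in ends j1 by rewrite -e E3 in_set2 eqxx.
  by rewrite E1 in_set2 (negbTE xv) (negbTE xw).
have : uniq [:: i0; j1; j2; j3].
  by rewrite /= !inE !negb_or (eq_sym i0 j1) (eq_sym i0 j2) (eq_sym i0 j3) (eq_sym j1 j2) (eq_sym j1 j3) (eq_sym j2 j3) j10 j20 j30 j21 j31 j32.
move=> /card_uniqP /= c4; rewrite -[4]c4; apply: subset_leq_card; apply/subsetP => j.
by rewrite !inE => /or4P[] /eqP ->.
Qed.

End Girth.

Section Euler.
Variables (V I : finType) (endv : I -> bool -> V) (S : {set V}).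
Hypothesis loopless : forall i, endv i false != endv i true.
Hypothesis ends_inj : injective (ends endv).
Hypothesis triangle_free : forall a b c i j k,
  ends endv i = [set a; b] -> ends endv j = [set b; c] -> ends endv k = [set a; c] -> False.
Hypothesis ends_in : forall i b, endv i b \in S.
Hypothesis S_ge3 : 3 <= #|S|.

Notation face := {ffun {set I} -> bool}.
Variable l : I -> face.
Let r i : face := xor_ffun (l i) (edge_form endv i).
(** The edges with the form [f] on exactly one side. *)
Definition boundary (f : face) : {set I} := [set i | (l i == f) (+) (r i == f)].
Hypothesis boundary_even : forall f, evenset endv (boundary f).

Local Open Scope ring_scope.

Lemma F2_addb (b c : bool) : (b (+) c)%:R = b%:R + c%:R :> 'F_2.
Proof. by apply/val_inj; case: b; case: c. Qed.

Lemma F2_sum (J : finType) (P : pred J) (h : J -> bool) :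
  (\big[addb/false]_(j | P j) h j)%:R = \sum_(j | P j) (h j)%:R :> 'F_2.
Proof. by apply: (big_morph (fun b : bool => b%:R : 'F_2)) => // b c; apply: F2_addb. Qed.

Lemma F2_val (x : 'F_2) : x = (x != 0)%:R.
Proof. by apply/val_inj; case: x => [[|[|]]]. Qed.

Definition incidence : 'M['F_2]_(#|I|, #|S|) :=
  \matrix_(i, j) ((endv (enum_val i) false == enum_val j) (+)
                  (endv (enum_val i) true == enum_val j))%:R.

Definition brow (f : face) : 'rV['F_2]_#|I| := \row_i (enum_val i \in boundary f)%:R.

(** Each edge has two ends, so the columns add up to zero. *)
Lemma rank_incidence : (\rank incidence < #|S|)%N.
Proof.
have S0 : (0 < #|S|)%N by apply: leq_trans S_ge3.
have h0 : incidence *m (const_mx 1 : 'cV_#|S|) = 0.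
  apply/matrixP => i k; rewrite !mxE.
  under eq_bigr do rewrite !mxE mulr1 F2_addb.
  rewrite big_split /=.
  have one b : \sum_(j < #|S|) (endv (enum_val i) b == enum_val j)%:R = 1 :> 'F_2.
    rewrite (bigD1 (enum_rank_in (ends_in (enum_val i) b) (endv (enum_val i) b))) //=.
    rewrite enum_rankK_in // eqxx big1 ?addr0 // => j ne.
    case: eqVneq => // e; case/eqP: ne; apply: enum_val_inj.
    by rewrite enum_rankK_in.
  by rewrite !one; apply/val_inj.
have := mulmx0_rank_max h0.
suff -> : \rank (const_mx 1 : 'cV['F_2]_#|S|) = 1%N by rewrite addn1.
apply/eqP; rewrite -mxrank_tr trmx_const rank_rV.
suff -> : (const_mx 1 : 'rV['F_2]_#|S|) != 0 by [].
by apply/eqP => /rowP/(_ (Ordinal S0)); rewrite !mxE => /eqP; rewrite oner_eq0.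
Qed.

(** Over F_2 the coefficient of the edge i in the even set z is
    [l i z + r i z], which is the sum over all forms f of f z times the
    membership of i in the boundary of f. *)
Lemma kernel_even (v : 'rV['F_2]_#|I|) : v *m incidence = 0 ->
  v = \sum_(f : face) (f [set i | v 0 (enum_rank i) != 0])%:R *: brow f.
Proof.
move=> v0; set z := [set i | _].
have zE i : v 0 (enum_rank i) = (i \in z)%:R by rewrite inE -F2_val.
have ev : evenset endv z.
  apply/forallP => u; apply/negP => odd.
  have [uS|uS] := boolP (u \in S); last first.
    move: odd; rewrite big1 // => i _.
    have ne b : (endv i b == u) = false by apply: contraNF uS => /eqP <-.
    by rewrite !ne.
  move/matrixP/(_ 0 (enum_rank_in uS u)): v0; rewrite !mxE.
  rewrite (reindex (@enum_rank I)) /=; last by apply: onW_bij; apply: enum_rank_bij.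
  under eq_bigr do rewrite zE !mxE enum_rankK enum_rankK_in //.
  move=> sum0; have : (\big[addb/false]_(i in z)
      ((endv i false == u) (+) (endv i true == u)))%:R = 0 :> 'F_2.
    rewrite F2_sum big_mkcond -[RHS]sum0; apply: eq_bigr => i _.
    by case: (i \in z); rewrite ?mul1r ?mul0r.
  by rewrite odd => /eqP; rewrite oner_eq0.
apply/rowP => i0; rewrite -(enum_valK i0); set i := enum_val i0.
rewrite zE summxE.
under eq_bigr do rewrite !mxE enum_rankK.
have -> : (i \in z) = \big[addb/false]_(f : face) (f z && (i \in boundary f)).
  have one (g : face) : \big[addb/false]_(f : face) (f z && (g == f)) = g z.
    rewrite (bigD1 g) //= eqxx andbT big1 ?addbF // => f ne.
    by rewrite eq_sym (negbTE ne) andbF.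
  under eq_bigr do rewrite inE andb_addr.
  by rewrite big_split /= !one ffunE [edge_form _ _ _]ffunE ev /= addbA addbb.
rewrite F2_sum; apply: eq_bigr => f _.
by case: (f z); rewrite ?mul1r ?mul0r.
Qed.

Lemma brow_sum : \sum_(f : face) brow f = 0.
Proof.
apply/rowP => i; rewrite summxE !mxE.
under eq_bigr do rewrite mxE inE F2_addb.
have one (g : face) : \sum_(f : face) (g == f)%:R = 1 :> 'F_2.
  by rewrite (bigD1 g) //= eqxx big1 ?addr0 // => f ne; rewrite eq_sym (negbTE ne).
by rewrite big_split /= !one; apply/val_inj.
Qed.

(** The boundaries span the cycle space, of dimension at least
    |I| - |S| + 1, and they add up to zero, so at least |I| - |S| + 2 of them are
    nonempty.  Each of these has at least four edges, and an edge lies in at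
    most two. *)
Lemma euler_bound : (#|I| + 4 <= 2 * #|S|)%N.
Proof.
pose F' := [set f | boundary f != set0].
have brow0 f : f \notin F' -> brow f = 0.
  rewrite inE negbK => /eqP b0; apply/rowP => i; by rewrite !mxE b0 inE.
have rk := rank_incidence.
have kr : \rank (kermx incidence) = (#|I| - \rank incidence)%N by rewrite mxrank_ker.
have count : (2 * #|F'| <= #|I|)%N.
  have : (4 * #|F'| <= \sum_(f in F') #|boundary f|)%N.
    rewrite mulnC -sum_nat_const; apply: leq_sum => f; rewrite inE => fF.
    exact: even_card.
  move=> /leq_trans h.
  rewrite -(@leq_pmul2l 2) // mulnA; apply: h.
  under eq_bigr do rewrite -sum1_card big_mkcond.
  rewrite exchange_big /= mulnC -sum_nat_const.
  apply: leq_sum => i _.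
  rewrite -big_mkcondr sum1_card.
  apply: leq_trans (_ : #|[set l i; r i]| <= 2)%N; last by rewrite cards2; case: eqP.
  apply: subset_leq_card; apply/subsetP => f; rewrite !inE => /andP[_].
  rewrite ![f == _]eq_sym.
  by rewrite [i \in _]inE; case: (l i == f); case: (r i == f).
have [F0|[f0 f0F]] := set_0Vmem F'.
  have k0 : kermx incidence = 0.
    apply/row_matrixP => k; rewrite row0.
    have /kernel_even -> : row k (kermx incidence) *m incidence = 0.
      by rewrite -row_mul mulmx_ker row0.
    by apply: big1 => f _; rewrite brow0 ?scaler0 // F0 inE.
  move: kr; rewrite k0 mxrank0; lia.
pose F'' := F' :\ f0.
pose Bm : 'M['F_2]_(#|F''|, #|I|) := \matrix_k brow (enum_val k).
have sub1 f : f \in F'' -> (brow f <= Bm)%MS.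
  move=> fF; have -> : brow f = row (enum_rank_in fF f) Bm.
    by rewrite rowK enum_rankK_in.
  exact: row_sub.
have sub2 f : f != f0 -> (brow f <= Bm)%MS.
  move=> ne; have [fF|/brow0 ->] := boolP (f \in F'); last exact: sub0mx.
  by apply: sub1; rewrite in_setD1 ne.
have sub f : (brow f <= Bm)%MS.
  have [->|] := eqVneq f f0; last exact: sub2.
  have := brow_sum; rewrite (bigD1 f0) //= => /eqP; rewrite addr_eq0 => /eqP ->.
  by rewrite eqmx_opp; apply: summx_sub.
have : (\rank (kermx incidence) <= #|F''|)%N.
  apply: leq_trans (rank_leq_row Bm); apply: mxrankS; apply/row_subP => k.
  have /kernel_even -> : row k (kermx incidence) *m incidence = 0.
    by rewrite -row_mul mulmx_ker row0.
  by apply: summx_sub => f _; apply: scalemx_sub.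
have := cardsD1 f0 F'; rewrite f0F -/F'' kr; lia.
Qed.

End Euler.

From mathcomp Require Import all_classical all_reals all_analysis.
Import numFieldNormedType.Exports.

Local Open Scope classical_set_scope.
Local Open Scope ring_scope.

(** * Compactness arguments for plane curves *)

Section Analysis.
Variable R : realType.
Implicit Types (F G : R -> R * R) (u : R * R).

(** Precomposing with the projection of the line to the unit interval turns
    continuity within the interval into plain continuity. *)
Lemma clamp_extension (g : R -> R * R) : {within `[0, 1], continuous g} ->
  exists2 G : R -> R * R, continuous G & {in `[0, 1], forall t, G t = g t}.
Proof.
move=> /subspace_continuousP gc.
pose c (t : R) : R := Num.max 0 (Num.min 1 t).
have c01 t : c t \in `[0, 1].
  by rewrite in_itv /= /c; apply/andP; split; [rewrite le_max lexx|rewrite ge_max ler01 ge_min lexx].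
exists (g \o c) => [t|t]; last first.
  rewrite in_itv /= => /andP[t0 t1] /=; congr g.
  by rewrite /c (min_idPr t1) (max_idPr t0).
apply: (@cvg_comp _ _ _ c g _ (within `[0, 1] (nbhs (c t)))); last by apply: gc; exact: c01.
move=> P; rewrite /within /= => nP.
have cc : continuous c.
  move=> x; apply: (@continuous_max _ _ (fun=> 0)); first exact: cvg_cst.
  by apply: (@continuous_min _ _ (fun=> 1)); [exact: cvg_cst|exact: cvg_id].
have := cc t _ nP; rewrite !nbhs_simpl /=; apply: filterS => x; apply.
exact: c01.
Qed.

Lemma far_apart F G (a b c d : R) : continuous F -> continuous G ->
  (forall s t, a <= s <= b -> c <= t <= d -> F s <> G t) ->
  exists2 e : R, 0 < e & forall s t, a <= s <= b -> c <= t <= d -> e <= `|F s - G t|.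
Proof.
move=> cF cG dis.
have [ab|ba] := leP a b; last by exists 1 => // s t /andP[? ?]; lra.
have [cd|dc] := leP c d; last by exists 1 => // s t _ /andP[? ?]; lra.
pose f (st : R * R) : R := `|F st.1 - G st.2|.
pose A : set (R * R) := `[a, b] `*` `[c, d].
have A0 : A !=set0 by exists (a, c); split => /=; rewrite in_itv /= lexx.
have Ac : compact A by apply: compact_setX; exact: segment_compact.
have fc : {within A, continuous f}.
  apply: continuous_subspaceT => st.
  apply: cvg_norm; apply: cvgB.
    by apply: (@continuous_comp _ _ _ (fun p : R * R => p.1) F); [exact: cvg_fst|exact: cF].
  by apply: (@continuous_comp _ _ _ (fun p : R * R => p.2) G); [exact: cvg_snd|exact: cG].
have [[s0 t0]] := compact_EVT_min A0 Ac fc.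
rewrite inE => -[/= s0ab t0cd] minf.
exists (f (s0, t0)).
  rewrite normr_gt0 subr_eq0; apply/eqP; apply: dis.
    by move: s0ab; rewrite in_itv.
  by move: t0cd; rewrite in_itv.
by move=> s t sab tcd; apply: (minf (s, t)); rewrite inE; split; rewrite /= in_itv.
Qed.

Lemma last_time G u (r : R) : continuous G -> `|G 0 - u| <= r ->
  exists t0, [/\ 0 <= t0 <= 1, `|G t0 - u| <= r & forall t, t0 < t <= 1 -> r < `|G t - u| ].
Proof.
move=> cG h0.
pose A : set R := `[0, 1] `&` [set t | `|G t - u| <= r].
have A0 : A !=set0 by exists 0; split => //=; rewrite in_itv /= lexx ler01.
have Ac : compact A.
  apply: compact_closedI; first exact: segment_compact.
  have -> : [set t | `|G t - u| <= r] = (fun t => `|G t - u|) @^-1` [set x | x <= r] by [].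
  apply: (@closed_comp _ _ (fun t => `|G t - u|)); last exact: closed_le.
  by move=> t _; apply: cvg_norm; apply: cvgB; [exact: cG|exact: cvg_cst].
have [|t0] := compact_EVT_max A0 Ac (f := id).
  by apply: continuous_subspaceT => x; exact: cvg_id.
rewrite inE => -[/=]; rewrite in_itv /= => t01 tr maxt.
exists t0; split=> // t /andP[t0t t1]; rewrite ltNge; apply/negP => le.
suff : t <= t0 by rewrite leNgt t0t.
apply: maxt; rewrite inE; split=> //=.
by rewrite in_itv /= t1 (le_trans _ (ltW t0t)) //; case/andP: t01.
Qed.

Lemma exit_time G u (r : R) : continuous G -> `|G 0 - u| <= r -> r < `|G 1 - u| ->
  exists t0, [/\ 0 <= t0 < 1, `|G t0 - u| = r & forall t, t0 < t <= 1 -> r < `|G t - u| ].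
Proof.
move=> cG h0 h1; have [t0 [/andP[t00 t01] le gt]] := last_time cG h0.
have t0lt : t0 < 1.
  by rewrite lt_neqAle t01 andbT; apply: contraTneq le => ->; rewrite -ltNge.
exists t0; split=> //; first by rewrite t00.
apply/eqP; rewrite eq_le le /= leNgt; apply/negP => lt.
have [||t] := @IVT R (fun t => `|G t - u|) t0 1 r t01.
- apply: continuous_subspaceT => t; apply: cvg_norm.
  by apply: cvgB; [exact: cG|exact: cvg_cst].
- by rewrite ge_min le le_max (ltW h1) orbT.
rewrite in_itv /= => /andP[t0t t1] e.
have : t0 < t by rewrite lt_neqAle t0t andbT; apply: contraTneq lt => ->; rewrite e ltxx.
by move=> h; have := gt t; rewrite h t1 e ltxx => /(_ isT).
Qed.

(** The points reachable by steps shorter than [e] form an interval, whose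
    supremum is itself reachable and, unless it is [b], can be passed. *)
Lemma eps_chain G (a b e : R) : continuous G -> a <= b -> 0 < e ->
  exists l : seq R, [/\ last a l = b, all (fun t => a <= t <= b) l
    & path (fun s t => `|G s - G t| < e) a l].
Proof.
move=> cG ab e0.
pose P (x : R) := a <= x <= b /\ exists l : seq R, [/\ last a l = x, all (fun t => a <= t <= x) l
    & path (fun s t => `|G s - G t| < e) a l].
have Pa : P a by split; [rewrite lexx ab|exists [::]].
have Pub : ubound P b by move=> x [/andP[]].
have hs : has_sup P by split; [exists a|exists b].
pose s := sup P.
have as_ : a <= s by apply: sup_upper_bound.
have sb : s <= b by apply: sup_le_ub => //; exists a.
have : nbhs s (fun t => `|G s - G t| < e / 2).
  have := cG s; move/cvgr_dist_lt => /(_ (e / 2)); rewrite divr_gt0 // => /(_ isT).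
  exact.
move=> /nbhs_ballP[d /= d0 dP].
have near_s t : `|s - t| < d -> `|G s - G t| < e / 2 by move=> h; apply: dP.
have [x [xab [l [lx la lp]]] sx] := sup_adherent d0 hs.
rewrite -/s in sx; have xs : x <= s by apply: sup_upper_bound => //; split=> //; exists l.
have step y : x <= y -> y <= b -> y < s + d -> P y.
  move=> xy yb ys; split; first by rewrite yb (le_trans _ xy) //; case/andP: xab.
  exists (rcons l y); split; first by rewrite last_rcons.
    rewrite all_rcons lexx (le_trans _ xy) ?andbT /=; last by case/andP: xab.
    by apply: sub_all la => t /andP[-> tx]; exact: le_trans xy.
  rewrite rcons_path lp lx /=.
  have h1 : `|G s - G x| < e / 2 by apply: near_s; rewrite ger0_norm ?subr_ge0 //; lra.
  have h2 : `|G s - G y| < e / 2.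
    by apply: near_s; rewrite ltr_norml; apply/andP; split; lra.
  have -> : G x - G y = (G s - G y) - (G s - G x) by rewrite opprB [RHS]addrC addrA subrK.
  by apply: le_lt_trans (ler_normB _ _) _; rewrite [ltRHS](splitr e) ltrD.
have [sb'|] := ltP s b; last first.
  move=> bs; have [||_ [l' [h1 h2 h3]]] := step b _ (lexx b); last by exists l'.
    by case/andP: xab.
  by apply: le_lt_trans bs _; rewrite ltrDl.
pose y := Num.min b (s + d / 2).
have : P y.
  apply: step; rewrite /y ?le_min ?ge_min ?lexx ?gt_min //=.
    case/andP: xab => _ ->; lra.
  by apply/orP; right; lra.
move=> /(sup_upper_bound hs); rewrite -/s /y leNgt lt_min sb' /= => /negP; case; lra.
Qed.

Definition seg_point (a b : R * R) (t : R) : R * R :=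
  (a.1 + t * (b.1 - a.1), a.2 + t * (b.2 - a.2)).

Lemma seg_point_continuous a b : continuous (seg_point a b).
Proof.
move=> t; rewrite /seg_point.
have lin (x y : R) : (fun s : R => x + s * y) @ t --> x + t * y.
  by apply: cvgD; [exact: cvg_cst|apply: cvgMr_tmp; exact: cvg_id].
exact: (cvg_pair (lin a.1 (b.1 - a.1)) (lin a.2 (b.2 - a.2))).
Qed.

Lemma norm_pairE (z : R * R) : `|z| = Num.max `|z.1| `|z.2|.
Proof. by []. Qed.

Lemma norm_pair_lt (z : R * R) (r : R) : (`|z| < r) = (`|z.1| < r) && (`|z.2| < r).
Proof. by rewrite norm_pairE gt_max. Qed.

Lemma seg_far a b u : ~ in_seg a b u ->
  exists2 e : R, 0 < e & forall z, in_seg a b z -> ~~ (`|z - u| < e).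
Proof.
move=> nu.
have [|e e0 eP] := @far_apart (seg_point a b) (fun=> u) 0 1 0 0
    (@seg_point_continuous a b) (fun=> cvg_cst _).
  by move=> s t s01 _ h; apply: nu; exists s.
exists e => // z [t t01 ->]; rewrite -leNgt.
by apply: (eP t 0) => //; rewrite lexx.
Qed.

End Analysis.

Local Close Scope classical_set_scope.

(** * The forms around a vertex of a clean drawing *)

Section Windows.
Variable R : realFieldType.
Implicit Types x y d e B r : R.

Lemma window x d B : 0 < d -> `|x| + d < B ->
  [/\ - B < x - d, x - d < x + d & x + d < B].
Proof.
move=> d0 xB; have := ler_norm x; have := ler_norm (- x); rewrite normrN.
by move=> *; split; lra.
Qed.

Lemma window_norm x d B y : 0 < d -> `|x| + d < B -> x - d <= y <= x + d -> `|y| <= B.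
Proof.
move=> d0 xB /andP[y1 y2]; have [w1 _ w3] := window d0 xB.
by rewrite ler_norml; apply/andP; split; lra.
Qed.

Lemma gap_separates x y d : 0 < d -> (x < y -> x + 2 * d < y) -> (y < x -> y + 2 * d < x) ->
  x - d <= y <= x + d -> y = x.
Proof.
by move=> d0 g1 g2 /andP[y1 y2]; case: (ltrgtP x y) => // [/g1|/g2]; lra.
Qed.

Lemma in_seg_beside (a b z : R * R) (c : R) : in_seg a b z ->
  (c < a.1) && (c < b.1) || (a.1 < c) && (b.1 < c) -> z.1 != c.
Proof.
move=> zab; have [ab|/ltW ab] := leP a.1 b.1.
  move: (in_seg_between (lo := a.1) (hi := b.1) zab); rewrite !lexx ab => /(_ isT isT)/andP[? ?].
  by case/orP => /andP[? ?]; [rewrite gt_eqF|rewrite lt_eqF] => //; lra.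
move: (in_seg_between (lo := b.1) (hi := a.1) zab); rewrite !lexx ab => /(_ isT isT)/andP[? ?].
by case/orP => /andP[? ?]; [rewrite gt_eqF|rewrite lt_eqF] => //; lra.
Qed.

End Windows.

Section Clean.
Variables (R : realType) (V I : finType) (endv : I -> bool -> V).
Variables (pos : V -> R * R) (rad : I -> bool -> R * R) (inner : I -> seq (R * R)).

Notation on_radius i b := (in_seg (pos (endv i b)) (rad i b)).
Notation isegs := (inner_segs rad inner).

(** Polygonal drawings in which distinct edges meet only at common ends.
    Nothing is required of an edge with respect to itself: a
    self-intersection changes winding parities only by [edge_form] of this
    edge, which [same_sides] disregards. *)
Record clean_drawing : Prop := CleanDrawing {
  cl_loop : forall i, endv i false != endv i true;
  cl_last : forall i, last (rad i false) (inner i) = rad i true;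
  cl_inner : forall i j ab cd, i != j -> ab \in isegs i -> cd \in isegs j ->
    seg_disj ab.1 ab.2 cd.1 cd.2;
  cl_inner_rad : forall i j b ab, i != j -> ab \in isegs i ->
    seg_disj ab.1 ab.2 (pos (endv j b)) (rad j b);
  cl_rad : forall i j b c z, i != j -> on_radius i b z -> on_radius j c z ->
    endv i b = endv j c /\ z = pos (endv i b);
  cl_inner_pos : forall i ab u, ab \in isegs i -> ~ in_seg ab.1 ab.2 (pos u);
  cl_rad_pos : forall i b u, on_radius i b (pos u) -> endv i b = u;
  cl_rad_neq : forall i b, rad i b != pos (endv i b) }.

Hypothesis cl : clean_drawing.
(** With no vertical end piece, all the end pieces at a vertex u cross one of
    the two vertical sides of a flat rectangle centred at u. *)
Hypothesis not_vertical : forall i b, (rad i b).1 != (pos (endv i b)).1.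

Lemma clear_box u : exists2 e : R, 0 < e & forall z, `|z - pos u| < e ->
  (forall i ab, ab \in isegs i -> ~ in_seg ab.1 ab.2 z) /\
  (forall i b, endv i b != u -> ~ on_radius i b z).
Proof.
have [e1 e10 P1] : exists2 e : R, 0 < e & forall i, forall ab, ab \in isegs i ->
    forall z, `|z - pos u| < e -> ~ in_seg ab.1 ab.2 z.
  apply: (@fin_small _ _ (fun i e => forall ab, ab \in isegs i ->
    forall z, `|z - pos u| < e -> ~ in_seg ab.1 ab.2 z)).
    by move=> i d e /andP[_ de] h ab abi z zd; apply: (h ab abi); apply: lt_le_trans de.
  move=> i; apply: (@seq_small _ _ _ (fun ab e => forall z, `|z - pos u| < e ->
     ~ in_seg ab.1 ab.2 z)).
    by move=> ab d e /andP[_ de] h z zd; apply: h; apply: lt_le_trans de.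
  move=> ab abi; have [e e0 eP] := seg_far (cl_inner_pos cl (u := u) abi).
  by exists e => // z zd /eP; rewrite zd.
have [e2 e20 P2] : exists2 e : R, 0 < e & forall ib : I * bool, endv ib.1 ib.2 != u ->
    forall z, `|z - pos u| < e -> ~ on_radius ib.1 ib.2 z.
  apply: (@fin_small _ _ (fun ib e => endv ib.1 ib.2 != u ->
    forall z, `|z - pos u| < e -> ~ on_radius ib.1 ib.2 z)).
    by move=> i d e /andP[_ de] h ne z zd; apply: (h ne); apply: lt_le_trans de.
  move=> [i b] /=; have [->|ne] := eqVneq (endv i b) u; first by exists 1.
  have [|e e0 eP] := @seg_far _ (pos (endv i b)) (rad i b) (pos u).
    by move=> /(cl_rad_pos cl) h; rewrite h eqxx in ne.
  by exists e => // _ z zd /eP; rewrite zd.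
exists (Num.min e1 e2) => [|z]; first by rewrite lt_min e10.
rewrite lt_min => /andP[z1 z2]; split=> [i ab abi|i b ne]; first exact: (P1 i).
exact: (P2 (i, b)).
Qed.

Definition dx i b := (rad i b).1 - (pos (endv i b)).1.
Definition slope i b := ((rad i b).2 - (pos (endv i b)).2) / dx i b.

Lemma dx_neq0 i b : dx i b != 0.
Proof. by rewrite subr_eq0; apply: not_vertical. Qed.

Lemma on_radiusP i b z : on_radius i b z ->
  [/\ z.2 = (pos (endv i b)).2 + slope i b * (z.1 - (pos (endv i b)).1),
      0 <= (z.1 - (pos (endv i b)).1) * dx i b
    & `|z.1 - (pos (endv i b)).1| <= `|dx i b| ].
Proof.
move=> [t /andP[t0 t1] ->] /=; rewrite -/(dx i b) addrAC subrr add0r; split.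
- by congr (_ + _); rewrite /slope; field; apply: dx_neq0.
- by rewrite -mulrA mulr_ge0 // -expr2 sqr_ge0.
- by rewrite normrM ger0_norm // ler_piMl.
Qed.

Lemma on_radiusI i b x : 0 <= x * dx i b -> `|x| <= `|dx i b| ->
  on_radius i b ((pos (endv i b)).1 + x, (pos (endv i b)).2 + slope i b * x).
Proof.
have d0 := dx_neq0 i b.
move=> x0 xd; exists (x / dx i b); last first.
  by congr pair; rewrite /slope -/(dx i b); field.
have d2 : 0 < dx i b * dx i b by rewrite -expr2 exprn_even_gt0 //= d0.
have -> : x / dx i b = x * dx i b / (dx i b * dx i b) by field.
rewrite divr_ge0 ?(ltW d2) //= ler_pdivrMr // mul1r.
rewrite (le_trans (ler_norm _)) // normrM -[leRHS]ger0_norm ?(ltW d2) // normrM.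
by rewrite ler_pM2r // normr_gt0.
Qed.

Lemma in_seg_convex (a b p q z : R * R) :
  in_seg a b p -> in_seg a b q -> in_seg p q z -> in_seg a b z.
Proof.
move=> [s s01 ->] [t t01 ->] [v v01 ->]; exists (s + v * (t - s)); last first.
  by rewrite /=; congr pair; ring.
by apply/andP; split; nra.
Qed.

Lemma avoids_sub j (p q p' q' : R * R) : in_seg p q p' -> in_seg p q q' ->
  avoids endv pos rad inner j p q -> avoids endv pos rad inner j p' q'.
Proof.
move=> hp hq [h1 h2]; split=> [b|ab abj] z z1 z2; have z3 := in_seg_convex hp hq z2.
  exact: h1 z1 z3.
exact: h2 z1 z3.
Qed.

Lemma in_seg_l (a b : R * R) : in_seg a b a.
Proof. by exists 0; [lra|case: a => *; congr pair; rewrite /= mul0r addr0]. Qed.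

Lemma in_seg_r (a b : R * R) : in_seg a b b.
Proof. exact/in_seg_sym/in_seg_l. Qed.

Lemma avoids_near u e j p q :
  (forall z, `|z - pos u| < e ->
    (forall i ab, ab \in isegs i -> ~ in_seg ab.1 ab.2 z) /\
    (forall i b, endv i b != u -> ~ on_radius i b z)) ->
  (forall z, in_seg p q z -> `|z - pos u| < e) ->
  (forall b z, endv j b = u -> on_radius j b z -> in_seg p q z -> False) ->
  avoids endv pos rad inner j p q.
Proof.
move=> box near nrad; split=> [b z z1 z2|ab abj z z1 z2].
  have [eu|ne] := eqVneq (endv j b) u; first exact: nrad z1 z2.
  by have [_ /(_ j b ne)] := box z (near z z2).
by have [/(_ j ab abj)] := box z (near z z2).
Qed.

(** The rectangle has half-width [r] and half-height [B = K r], where [K] exceeds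
    all slopes, so each end piece at u leaves it through the left or the right
    side, at the height [hy h]; [wl h] and [wr h] are the forms just below and just
    above this exit.  Along each vertical side [line_parity] leaves the forms of
    the two corners, and these agree on both sides because the top and the
    bottom of the rectangle meet no edge. *)
Lemma sides_at u : exists wl wr : I * bool -> {ffun {set I} -> bool},
  (forall i b, endv i b = u ->
     wr (i, b) = xor_ffun (wl (i, b)) (edge_form endv i) /\
     same_sides endv i (winding endv pos rad inner (rad i b)) (wl (i, b))) /\
  forall f, \big[addb/false]_(h : I * bool | endv h.1 h.2 == u)
     ((wl h == f) (+) (wr h == f)) = false.
Proof.
pose u1 := (pos u).1; pose u2 := (pos u).2.
have [e e0 box] := clear_box u.
(* at least 1, so that the rectangle is at least as high as it is wide *)
pose K : R := 1 + \sum_(h : I * bool) `|slope h.1 h.2|.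
have KP i b : `|slope i b| < K.
  rewrite /K (bigD1 (i, b)) //= addrCA ltrDl ltr_wpDr // sumr_ge0 // => h _.
have K1 : 1 <= K by rewrite lerDl sumr_ge0 // => h _.
have [d1 d10 d1P] : exists2 d : R, 0 < d & forall h : I * bool, d < `|dx h.1 h.2|.
  apply: (@fin_small _ _ (fun h d => d < `|dx h.1 h.2|)).
    by move=> h x y /andP[_ xy] yd; apply: le_lt_trans yd.
  move=> h; exists (`|dx h.1 h.2| / 2); first by rewrite divr_gt0 // normr_gt0 dx_neq0.
  by rewrite ltr_pdivrMr // mulr_natr mulr2n ltrDl normr_gt0 dx_neq0.
pose r : R := Num.min d1 (e / 2 / K).
have K0 : 0 < K by lra.
have r0 : 0 < r by rewrite lt_min d10 !divr_gt0.
have rd i b : r < `|dx i b| by apply: le_lt_trans (d1P (i, b)); rewrite ge_min lexx.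
pose B := K * r.
have Be : B < e.
  have : r <= e / 2 / K by rewrite ge_min lexx orbT.
  by rewrite ler_pdivlMr // mulrC => /le_lt_trans; apply; rewrite ltr_pdivrMr // ltr_pMr // ltr1n.
have rB : r <= B by rewrite /B ler_peMl // ltW.
pose sg (s : bool) : R := if s then 1 else -1.
pose side (h : I * bool) := 0 < dx h.1 h.2.
pose pt s y : R * R := (u1 + sg s * r, u2 + y).
pose hy (h : I * bool) := slope h.1 h.2 * (sg (side h) * r).
have sgn s : `|sg s * r| = r.
  by rewrite normrM (gtr0_norm r0); case: s => /=; rewrite ?normrN normr1 mul1r.
have hyB h : `|hy h| < B by rewrite /hy normrM sgn /B ltr_pM2r.
have pt_close s y : `|y| <= B -> `|pt s y - pos u| < e.
  move=> yB; rewrite norm_pair_lt /= addrAC subrr add0r sgn (le_lt_trans rB Be) /=.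
  by rewrite addrAC subrr add0r (le_lt_trans yB).
have on_rad i b s y : endv i b = u -> on_radius i b (pt s y) ->
    s = side (i, b) /\ y = hy (i, b).
  move=> eu /on_radiusP[]; rewrite eu /= -/u1 -/u2 (addrAC u1) subrr add0r => /addrI yE sd _.
  have sE : s = side (i, b).
    move: sd; rewrite /side /= mulrAC; case: s {yE} => /=.
      by rewrite mul1r pmulr_lge0 // le0r (negbTE (dx_neq0 i b)).
    rewrite mulN1r pmulr_lge0 // oppr_ge0 leNgt => /negbTE ->//.
  by split=> //; rewrite yE sE.
have rad_on i b : endv i b = u -> on_radius i b (pt (side (i, b)) (hy (i, b))).
  move=> eu; rewrite /pt /u1 /u2 -eu; apply: on_radiusI; last by rewrite sgn ltW.
  rewrite /side /=; case: ltP => h /=; first by rewrite mul1r mulr_ge0 // ltW.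
  by rewrite mulN1r mulNr oppr_ge0 mulr_ge0_le0 // ltW.
have hy_inj h h' : endv h.1 h.2 = u -> endv h'.1 h'.2 = u -> side h = side h' ->
    hy h = hy h' -> h = h'.
  move: h h' => [i b] [j c] /= iu ju ss hh.
  have [ij|ij] := eqVneq i j; last first.
    have h1 := rad_on _ _ iu; have h2 := rad_on _ _ ju; rewrite -ss -hh in h2.
    have [_] := cl_rad cl ij h1 h2; rewrite iu => /(congr1 fst) /= E.
    have {}E : sg (side (i, b)) * r = 0 by move: E; rewrite -/u1; lra.
    by have := sgn (side (i, b)); rewrite E normr0 => r00; move: r0; rewrite -r00 ltxx.
  rewrite ij in iu *; have := cl_loop cl j.
  by case: b c iu ju {ss hh} => [] [] // -> ->; rewrite eqxx.
(* the points just below and above two exits do not interleave *)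
have [d d0 [dB dgap]] : exists2 d : R, 0 < d & (forall h, `|hy h| + d < B) /\
    (forall h h', hy h < hy h' -> hy h + 2 * d < hy h').
  have [x x0 xP] : exists2 d : R, 0 < d & forall h, `|hy h| + d < B.
    apply: fin_small => [h x y /andP[_ xy] yP|h]; first by lra.
    by exists ((B - `|hy h|) / 2); have := hyB h; lra.
  have [y y0 yP] : exists2 d : R, 0 < d & forall hh : (I * bool) * (I * bool),
      hy hh.1 < hy hh.2 -> hy hh.1 + 2 * d < hy hh.2.
    apply: (@fin_small _ _ (fun hh d => hy hh.1 < hy hh.2 -> hy hh.1 + 2 * d < hy hh.2)).
      by move=> h x' y /andP[_ xy] yP /yP; lra.
    move=> h; have [lt|ge] := ltP (hy h.1) (hy h.2); last by exists 1.
    by exists ((hy h.2 - hy h.1) / 4) => [|_]; lra.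
  exists (Num.min x y); first by rewrite lt_min x0.
  have mx : Num.min x y <= x by rewrite ge_min lexx.
  have my : Num.min x y <= y by rewrite ge_min lexx orbT.
  split=> [h|h h' /(yP (h, h')) /=]; first by have := xP h; lra.
  by lra.
pose W s y := winding endv pos rad inner (pt s y).
have vert s y y' z : in_seg (pt s y) (pt s y') z -> y <= y' ->
    exists2 y'', y <= y'' <= y' & z = pt s y''.
  move=> [t t01 ->] /= yy; exists (y + t * (y' - y)); first by nra.
  by rewrite /pt; congr pair; ring.
have av_vert j s y y' : -B <= y -> y <= y' -> y' <= B ->
    (forall b, endv j b = u -> side (j, b) = s -> ~~ (y <= hy (j, b) <= y')) ->
    avoids endv pos rad inner j (pt s y) (pt s y').
  move=> By yy yB nh; apply: (avoids_near (u := u) (e := e)) => //.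
    move=> z /vert /(_ yy) [y'' h ->]; apply: pt_close; rewrite ler_norml; lra.
  move=> b z ju onz /vert /(_ yy) [y'' h zE]; subst z.
  have [ss yh] := on_rad _ _ _ _ ju onz.
  by have := nh b ju (esym ss); rewrite -yh h.
have constW s y y' : -B <= y -> y <= y' -> y' <= B ->
    (forall h, endv h.1 h.2 = u -> side h = s -> ~~ (y <= hy h <= y')) -> W s y = W s y'.
  by move=> By yy yB nh; apply: (winding_eq (cl_last cl)) => j; apply: av_vert => // b; apply: (nh (j, b)).
have horiz y : `|y| = B -> W false y = W true y.
  move=> yB; apply: (winding_eq (cl_last cl)) => j.
  have hz z : in_seg (pt false y) (pt true y) z ->
      exists2 x, `|x| <= r & z = (u1 + x, u2 + y).
    move=> [t t01 ->] /=; exists ((2 * t - 1) * r); last by congr pair; ring.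
    by rewrite ler_norml; apply/andP; split; nra.
  apply: (avoids_near (u := u) (e := e)) => //.
    move=> z /hz [x xr ->]; rewrite norm_pair_lt /=.
    by rewrite !(addrAC _ y) !(addrAC _ x) !subrr !add0r yB Be andbT; lra.
  move=> b z ju /on_radiusP[z2 _ _] /hz [x xr zE]; move: z2.
  rewrite zE ju /= -/u1 -/u2 (addrAC u1) subrr add0r => /addrI yE.
  have : `|y| < B.
    rewrite yE normrM; apply: le_lt_trans (_ : `|slope j b| * r < _).
      by rewrite ler_wpM2l.
    by rewrite ltr_pM2r.
  by rewrite yB ltxx.
pose wl h := W (side h) (hy h - d); pose wr h := W (side h) (hy h + d).
have only_i i b j : endv i b = u -> j != i ->
    avoids endv pos rad inner j (pt (side (i, b)) (hy (i, b) - d))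
      (pt (side (i, b)) (hy (i, b) + d)).
  move=> iu ji; have [w1 w2 w3] := window d0 (dB (i, b)).
  apply: av_vert; rewrite ?ltW // => c jv ss; apply/negP => near.
  have := gap_separates d0 (dgap (i, b) (j, c)) (dgap (j, c) (i, b)) near.
  by move=> /(hy_inj (j, c) (i, b) jv iu ss)[ij]; rewrite ij eqxx in ji.
have near_cross h z : in_seg (pt (side h) (hy h - d)) (pt (side h) (hy h + d)) z ->
    `|z - pos u| < e.
  have [_ w2 _] := window d0 (dB h).
  move=> /vert[|y near ->]; first exact: ltW.
  exact/pt_close/(window_norm d0 (dB h)).
exists wl, wr; split.
  move=> i b iu; split.
    rewrite /wr /wl /W; apply: (@winding_cross _ _ _ _ _ _ _ _ i b) => //.
    - exact: cl_last.
    - by move=> j ji; apply: only_i.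
    - move=> ab abi z z1 /near_cross /box[/(_ i ab abi)] //.
    - have ne : endv i (~~ b) != u.
        have := cl_loop cl i; rewrite -iu; case: (b) => //; by rewrite eq_sym.
      by move=> z z1 /near_cross /box[_ /(_ i (~~ b) ne)].
    - have yE : height (pos (endv i b)) (rad i b) (pt (side (i, b)) (hy (i, b) + d)).1 =
          u2 + hy (i, b).
        rewrite iu /height /= -/u1 -/u2 (addrAC u1) subrr add0r /hy /slope iu /=.
        by rewrite /dx iu; ring.
      by rewrite /upcross yE /= ltrD2l ltNge lerDl (ltW d0) andbF.
    - have yE : height (pos (endv i b)) (rad i b) (pt (side (i, b)) (hy (i, b) - d)).1 =
          u2 + hy (i, b).
        rewrite iu /height /= -/u1 -/u2 (addrAC u1) subrr add0r /hy /slope iu /=.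
        by rewrite /dx iu; ring.
      rewrite /upcross yE /= ltrD2l gtrBl d0 andbT iu -/u1.
      have := rd i b; rewrite /side /= /dx iu -/u1.
      case: (ltP 0 ((rad i b).1 - u1)) => h.
        by rewrite gtr0_norm // mul1r lerDl (ltW r0) => h2; rewrite leNgt negbK; lra.
      rewrite ler0_norm // mulN1r => h2.
      have -> : (u1 <= u1 - r) = false by apply/negbTE; rewrite -ltNge; lra.
      have -> // : (rad i b).1 <= u1 - r by lra.
  pose m := pt (side (i, b)) (hy (i, b)).
  have := winding_near_chain (cl_last cl) (i := i) (x := rad i b)
    (l := [:: m; pt (side (i, b)) (hy (i, b) - d)]) (endv := endv) (pos := pos).
  apply=> j ab ji; rewrite !inE => /orP[] /eqP -> /=; last first.
    apply: avoids_sub (only_i i b j iu ji); last exact: in_seg_l.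
    exists (1 / 2); first by lra.
    by rewrite /m /pt /=; congr pair; field.
  have mid z : in_seg (rad i b) m z -> on_radius i b z /\ z.1 != u1.
    move=> zm; split.
      by apply: in_seg_convex zm; [exact: in_seg_r|exact: rad_on].
    have dxE : (rad i b).1 = u1 + dx i b by rewrite /dx iu addrC subrK.
    apply: in_seg_beside zm _; rewrite /m /pt dxE /= !ltrDl !gtrDl /side /=.
    have := dx_neq0 i b; case: (ltrgtP 0 (dx i b)) => [h|h|_] //= _.
      by rewrite mul1r r0.
    by rewrite mulN1r oppr_lt0 r0.
  split=> [c z z1 /mid[z2 z3]|cd cdj z z1 /mid[z2 _]].
    have [_ zE] := cl_rad cl ji z1 z2.
    have [e1 _] := cl_rad cl ji z1 z2.
    by move: z3; rewrite zE e1 iu eqxx.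
  exact: (cl_inner_rad cl ji cdj z1 z2).
move=> f.
have Fs s : \big[addb/false]_(h : I * bool | (endv h.1 h.2 == u) && (side h == s))
     ((wl h == f) (+) (wr h == f)) = (W s (- B) == f) (+) (W s B == f).
  rewrite -big_filter; set l := [seq h <- _ | _].
  have lP h : h \in l -> endv h.1 h.2 = u /\ side h = s.
    by rewrite mem_filter => /andP[/andP[/eqP ? /eqP ?] _].
  rewrite -(@line_parity _ _ (W s) [seq hy h | h <- l] d) //.
  - by rewrite big_map; apply: eq_big_seq => h /lP[_ hs]; rewrite /wl /wr hs.
  - rewrite map_inj_in_uniq ?filter_uniq ?index_enum_uniq // => h h' /lP[h1 h2] /lP[h3 h4].
    by apply: hy_inj; rewrite ?h2 ?h4.
  - lra.
  - by move=> _ _ /mapP[h _ ->] /mapP[h' _ ->]; apply: dgap.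
  - by move=> _ /mapP[h _ ->]; have [] := window d0 (dB h).
  - move=> y z h1 h2 h3 nh; apply: constW => // h hu hs; apply: nh; apply: map_f.
    by rewrite mem_filter hu hs !eqxx mem_index_enum.
rewrite (bigID side) /=.
rewrite (eq_bigl (fun h => (endv h.1 h.2 == u) && (side h == true))); last first.
  by move=> h; rewrite eqb_id.
rewrite Fs (eq_bigl (fun h => (endv h.1 h.2 == u) && (side h == false))); last first.
  by move=> h; rewrite eqbF_neg.
have B0 : 0 <= B by lra.
by rewrite Fs !horiz ?normrN ?ger0_norm ?addbb.
Qed.

End Clean.

(** * Making the end pieces non-vertical *)

Section Shear.
Variable R : realType.
Implicit Types a b z : R * R.

Definition shear (k : R) z : R * R := (z.1 + k * z.2, z.2).

Lemma shearK k : cancel (shear k) (shear (- k)).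
Proof. by case=> x y; rewrite /shear /=; congr pair; ring. Qed.

Lemma in_seg_shear k a b z : in_seg (shear k a) (shear k b) z <-> in_seg a b (shear (- k) z).
Proof.
split=> -[t t01 zE]; exists t => //.
  by rewrite zE /shear /=; congr pair; ring.
rewrite -[z](shearK (- k)) opprK zE /shear /=.
by congr pair; ring.
Qed.

Lemma seg_disj_shear k a b p q : seg_disj a b p q ->
  seg_disj (shear k a) (shear k b) (shear k p) (shear k q).
Proof. by move=> dis z /in_seg_shear z1 /in_seg_shear z2; apply: dis z1 z2. Qed.

Lemma chain_shear k a (l : seq (R * R)) :
  chain (shear k a) (map (shear k) l) = [seq (shear k ab.1, shear k ab.2) | ab <- chain a l].
Proof. by rewrite /chain; elim: l a => //= b l IH a; rewrite IH. Qed.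

Lemma avoid_finite (s : seq R) : exists k, k \notin s.
Proof.
pose k := 1 + \sum_(x <- s) `|x|; exists k; apply/negP => ks.
have : k <= \sum_(x <- s) `|x|.
  rewrite (perm_big _ (perm_to_rem ks)) big_cons /= -[leLHS]addr0.
  by rewrite lerD ?ler_norm // sumr_ge0.
by rewrite /k; lra.
Qed.

Variables (V I : finType) (endv : I -> bool -> V).
Variables (pos : V -> R * R) (rad : I -> bool -> R * R) (inner : I -> seq (R * R)).

Lemma clean_shear k : clean_drawing endv pos rad inner ->
  clean_drawing endv (shear k \o pos) (fun i (c : bool) => shear k (rad i c)) (fun i => map (shear k) (inner i)).
Proof.
case=> h1 h2 h3 h4 h5 h6 h7 h8.
have segs i : inner_segs (fun i (c : bool) => shear k (rad i c)) (fun i => map (shear k) (inner i)) i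
    = [seq (shear k ab.1, shear k ab.2) | ab <- inner_segs rad inner i].
  exact: chain_shear.
split=> //.
- by move=> i; rewrite last_map h2.
- move=> i j ab0 cd0 ij; rewrite !segs => /mapP[ab abi ->] /mapP[cd cdj ->].
  by apply: seg_disj_shear; apply: (h3 _ _ _ _ ij).
- move=> i j c ab0 ij; rewrite !segs => /mapP[ab abi ->].
  by apply: seg_disj_shear; apply: (h4 _ _ _ _ ij).
- move=> i j c0 c1 z ij /in_seg_shear z1 /in_seg_shear z2.
  have [-> e2] := h5 _ _ _ _ _ ij z1 z2; split=> //=.
  by rewrite -e2 -{1}[k]opprK shearK.
- move=> i ab0 u; rewrite segs => /mapP[ab abi ->] /in_seg_shear /=.
  by rewrite shearK; apply: (h6 _ _ _ abi).
- by move=> i c u /= /in_seg_shear /=; rewrite shearK; apply: h7.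
- by move=> i c /=; rewrite (can_eq (shearK k)).
Qed.

(** Each end piece becomes vertical for at most one shear. *)
Lemma clean_nonvertical : clean_drawing endv pos rad inner ->
  exists k, forall i (c : bool), (shear k (rad i c)).1 != (shear k (pos (endv i c))).1.
Proof.
move=> cl; pose d (ib : I * bool) := rad ib.1 ib.2 - pos (endv ib.1 ib.2).
have [k kP] := avoid_finite [seq - (d ib).1 / (d ib).2 | ib <- enum {: I * bool}].
exists k => i c; rewrite -subr_eq0.
have -> : (shear k (rad i c)).1 - (shear k (pos (endv i c))).1 =
    (d (i, c)).1 + k * (d (i, c)).2 by rewrite /shear /d /=; ring.
have [y0|y0] := eqVneq (d (i, c)).2 0.
  rewrite y0 mulr0 addr0; apply: contraNneq (cl_rad_neq cl i c) => x0.
  rewrite -subr_eq0; apply/eqP; rewrite -/(d (i, c)).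
  by move: x0 y0; case: (d (i, c)) => x y /= -> ->.
apply: contra kP => /eqP e; apply/mapP; exists (i, c); first by rewrite mem_enum.
by apply: (mulIf y0); rewrite mulfVK // -[LHS](addKr (d (i, c)).1) e addr0.
Qed.

End Shear.

Section CleanEuler.
Variables (R : realType) (V I : finType) (endv : I -> bool -> V) (S : {set V}).
Variables (pos : V -> R * R) (rad : I -> bool -> R * R) (inner : I -> seq (R * R)).
Hypothesis cl : clean_drawing endv pos rad inner.
Hypothesis ends_inj : injective (ends endv).
Hypothesis triangle_free : forall a b c i j k,
  ends endv i = [set a; b] -> ends endv j = [set b; c] -> ends endv k = [set a; c] -> False.
Hypothesis ends_in : forall i b, endv i b \in S.
Hypothesis S_ge3 : (3 <= #|S|)%N.

(** Along an edge i the pair of forms on its two sides does not depend on the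
    end: the polygon of i avoids all the other edges. *)
Lemma nonvertical_euler : (forall i b, (rad i b).1 != (pos (endv i b)).1) ->
  (#|I| + 4 <= 2 * #|S|)%N.
Proof.
move=> nv; pose l i := winding endv pos rad inner (rad i false).
apply: (@euler_bound _ _ endv S (cl_loop cl) ends_inj triangle_free ends_in S_ge3 l) => f.
apply/forallP => u; apply/negP.
have [wl [wr [near sum0]]] := sides_at cl nv u.
have along i b : same_sides endv i (l i) (winding endv pos rad inner (rad i b)).
  case: b; last by left.
  rewrite -(cl_last cl); apply: (winding_near_chain (cl_last cl)) => j ab ji abi; split.
    have ij : i != j by rewrite eq_sym.
    by move=> b; apply: seg_disj_sym; apply: (cl_inner_rad cl ij abi).
  by move=> cd cdj; apply: (cl_inner cl ji).
have same i b : endv i b = u ->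
    (wl (i, b) == f) (+) (wr (i, b) == f) = (i \in boundary endv l f).
  move=> iu; have [-> n] := near i b iu; rewrite inE.
  have [->|->] := same_sides_trans (along i b) n; first by [].
  by rewrite xor_ffunK addbC.
have := sum0 f; rewrite (eq_bigr (fun h => h.1 \in boundary endv l f)); last first.
  by move=> [i b] /eqP iu; rewrite same.
have pairs (G : I -> bool -> bool) : \big[addb/false]_(h : I * bool) G h.1 h.2 =
    \big[addb/false]_i (G i false (+) G i true).
  rewrite -(pair_bigA _ G) /=; apply: eq_bigr => i _.
  by rewrite (bigD1 false) //= (bigD1 true) //= big1 ?addbF // => -[].
rewrite big_mkcond (pairs (fun i b => if endv i b == u then i \in boundary endv l f else false)).
move=> e0 e1; suff E : \big[addb/false]_(i in boundary endv l f)
    ((endv i false == u) (+) (endv i true == u)) = false by rewrite E in e1.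
rewrite big_mkcond -[RHS]e0; apply: eq_bigr => i _.
by case: (i \in boundary _ _ _); do 2 case: (_ == u).
Qed.

End CleanEuler.

Lemma clean_euler (R : realType) (V I : finType) (endv : I -> bool -> V) (S : {set V})
    (pos : V -> R * R) (rad : I -> bool -> R * R) (inner : I -> seq (R * R)) :
  clean_drawing endv pos rad inner -> injective (ends endv) ->
  (forall a b c i j k, ends endv i = [set a; b] -> ends endv j = [set b; c] ->
     ends endv k = [set a; c] -> False) ->
  (forall i b, endv i b \in S) -> (3 <= #|S|)%N -> (#|I| + 4 <= 2 * #|S|)%N.
Proof.
move=> cl inj tf inS S3; have [k nv] := clean_nonvertical cl.
exact: (nonvertical_euler (clean_shear k cl) inj tf inS S3 nv).
Qed.

(** * Clean drawings from arcs *)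

Section Norms.
Variable R : realType.
Implicit Types (a b u z : R * R).

Lemma seg_point_scale a b (t : R) : seg_point a b t - a = t *: (b - a).
Proof. by case: a b => [a1 a2] [b1 b2]; congr pair; rewrite /= addrAC subrr add0r. Qed.

Lemma seg_point_norm a b (t : R) : 0 <= t -> `|seg_point a b t - a| = t * `|b - a|.
Proof. by move=> t0; rewrite seg_point_scale normrZ ger0_norm. Qed.

Lemma in_seg_norm a b z : in_seg a b z -> `|z - a| <= `|b - a|.
Proof.
by move=> [t /andP[t0 t1] ->]; rewrite -/(seg_point a b t) seg_point_norm // ler_piMl.
Qed.

Lemma dist_lt2 u v z (e : R) : `|z - u| < e -> `|z - v| < e -> `|u - v| < 2 * e.
Proof.
move=> h1 h2; apply: le_lt_trans (ler_distD z u v) _.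
by rewrite distrC; lra.
Qed.

Lemma chain_near (G : R -> R * R) (a b e x : R) (l : seq R) ab z :
  a <= x <= b -> all (fun t => a <= t <= b) l -> path (fun s t => `|G s - G t| < e) x l ->
  ab \in chain (G x) (map G l) -> in_seg ab.1 ab.2 z ->
  exists2 s, a <= s <= b & `|z - G s| < e.
Proof.
rewrite /chain; elim: l x => //= y l IH x xab /andP[yab lab] /andP[xy yl].
rewrite in_cons => /predU1P[->|abl]; last exact: IH yl abl.
move=> /in_seg_norm /= zx; exists x => //.
by apply: le_lt_trans zx _; rewrite distrC.
Qed.

(** The part of an arc between its last point in the square around one end and
    the first later point in the square around the other end; the norm of the
    plane is the maximum norm. *)
Lemma trim (G : R -> R * R) (r : R) : continuous G -> 0 < r ->
  (forall z, `|z - G 0| <= r -> `|z - G 1| <= r -> False) ->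
  exists t0 t1, [/\ 0 < t0, t0 <= t1 < 1,
    `|G t0 - G 0| = r /\ `|G t1 - G 1| = r,
    forall t, t0 < t <= 1 -> r < `|G t - G 0|
    & forall t, t0 <= t < t1 -> r < `|G t - G 1| ].
Proof.
move=> cG r0 dis.
have [||t0 [/andP[t00 t01] e0 P0]] := @exit_time _ G (G 0) r cG.
- by rewrite subrr normr0 ltW.
- by rewrite ltNge; apply/negP => /dis; rewrite subrr normr0 ltW // => /(_ isT).
have t0p : 0 < t0.
  rewrite lt_neqAle t00 andbT; apply: contraTneq r0 => t0E.
  by rewrite -e0 -t0E subrr normr0 ltxx.
pose H s := G (1 - s * (1 - t0)).
have cH : continuous H.
  move=> s; apply: (@continuous_comp R R _ (fun s : R => 1 - s * (1 - t0)) G s); last exact: cG.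
  by apply: cvgB; [exact: cvg_cst|apply: cvgMr_tmp; exact: cvg_id].
have H0 : H 0 = G 1 by rewrite /H mul0r subr0.
have H1 : H 1 = G t0 by rewrite /H; congr G; ring.
have [||s0 [/andP[s00 s01] e1 P1]] := @exit_time _ H (G 1) r cH.
- by rewrite H0 subrr normr0 ltW.
- by rewrite ltNge H1; apply/negP => h; apply: (dis (G t0)); rewrite ?e0.
have d0 : 0 < 1 - t0 by rewrite subr_gt0.
exists t0, (1 - s0 * (1 - t0)); split => //.
- apply/andP; split; first by nra.
  rewrite ltrBlDl -ltrBlDr subrr mulr_gt0 // lt_neqAle s00 andbT.
  by apply: contraTneq r0 => sE; rewrite -e1 -sE H0 subrr normr0 ltxx.
- move=> t /andP[t0t tt]; have := P1 ((1 - t) / (1 - t0)).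
  rewrite /H mulfVK ?gt_eqF // subKr; apply.
  by rewrite ltr_pdivlMr // ler_pdivrMr //; apply/andP; split; lra.
Qed.

End Norms.

Section Arcs.
Variables (R : realType) (V I : finType) (endv : I -> bool -> V).
Variables (pos : V -> R * R) (G : I -> R -> R * R).
Hypothesis loopless : forall i, endv i false != endv i true.
Hypothesis pos_inj : injective pos.
Hypothesis G_cont : forall i, continuous (G i).
Hypothesis G0 : forall i, G i 0 = pos (endv i false).
Hypothesis G1 : forall i, G i 1 = pos (endv i true).
Hypothesis G_pos : forall i t u, 0 < t < 1 -> G i t <> pos u.
Hypothesis G_disj : forall i j s t, i != j -> 0 < s < 1 -> 0 < t < 1 -> G i s <> G j t.

(** Squares around the vertices that are disjoint and meet only the arcs that
    end at their centre. *)
Lemma squares : exists r : R, [/\ 0 < r,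
  forall u v z, `|z - pos u| <= r -> `|z - pos v| <= r -> u = v
  & forall i u t, u \notin ends endv i -> 0 <= t <= 1 -> r < `|G i t - pos u| ].
Proof.
have [r1 r10 P1] : exists2 e : R, 0 < e & forall uv : V * V, uv.1 != uv.2 ->
    2 * e < `|pos uv.1 - pos uv.2|.
  apply: (@fin_small _ _ (fun uv e => uv.1 != uv.2 -> 2 * e < `|pos uv.1 - pos uv.2|)).
    by move=> uv d e /andP[_ de] h /h; lra.
  move=> [u v]; have [->|ne] := eqVneq u v; first by exists 1.
  have p : 0 < `|pos u - pos v| by rewrite normr_gt0 subr_eq0 (inj_eq pos_inj).
  by exists (`|pos u - pos v| / 4) => //=; lra.
have [r2 r20 P2] : exists2 e : R, 0 < e & forall iu : I * V, iu.2 \notin ends endv iu.1 ->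
    forall t, 0 <= t <= 1 -> e < `|G iu.1 t - pos iu.2|.
  apply: (@fin_small _ _ (fun iu e => iu.2 \notin ends endv iu.1 ->
    forall t, 0 <= t <= 1 -> e < `|G iu.1 t - pos iu.2|)).
    by move=> iu d e /andP[_ de] h /h {}h t /h; apply: le_lt_trans.
  move=> [i u] /=; have [ui|ui] := boolP (u \in ends endv i); first by exists 1.
  have [|e e0 eP] := @far_apart R (G i) (fun=> pos u) 0 1 0 0 (@G_cont i) (fun=> cvg_cst _).
    move=> s t /andP[s0 s1] _ e; move: ui; rewrite !inE.
    have [s0'|s0'] := eqVneq s 0.
      by rewrite -(inj_eq pos_inj) -e s0' G0 eqxx.
    have [s1'|s1'] := eqVneq s 1.
      by rewrite orbC -(inj_eq pos_inj) -e s1' G1 eqxx.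
    by have := @G_pos i s u; rewrite !lt_neqAle eq_sym s0' s1' s0 s1 => /(_ isT e).
  exists (e / 2) => [|_ t t01]; first by rewrite divr_gt0.
  have := eP t 0 t01; rewrite lexx => /(_ isT); apply: lt_le_trans.
  by rewrite ltr_pdivrMr // ltr_pMr // ltr1n.
exists (Num.min r1 r2); split; first by rewrite lt_min r10.
- move=> u v z; rewrite !le_min => /andP[h1 _] /andP[h2 _].
  apply/eqP; apply: contraT => ne; have /= := P1 (u, v) ne.
  have := ler_distD z (pos u) (pos v); rewrite (distrC (pos u) z).
  by move: h1 h2; lra.
- by move=> i u t ui t01; rewrite gt_min (P2 (i, u) ui t t01) orbT.
Qed.

(** Each arc is cut at its squares, where it is continued by straight pieces to
    the two centres.  The middle parts are compact and disjoint from one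
    another and from the straight pieces of other edges, which leaves room for
    polygonal approximations.  Two straight pieces at one vertex end at
    distinct points of the boundary of a square, so they meet at its centre
    only. *)
Lemma clean_of_arcs : exists rad inner, clean_drawing endv pos rad inner.
Proof.
have [r [r0 sq_disj sq_far]] := squares.
have /all_tag[t0 /all_tag[t1 tP]] : forall i, {t0 : R & {t1 : R | [/\ 0 < t0, t0 <= t1 < 1,
    `|G i t0 - G i 0| = r /\ `|G i t1 - G i 1| = r,
    forall t, t0 < t <= 1 -> r < `|G i t - G i 0|
    & forall t, t0 <= t < t1 -> r < `|G i t - G i 1| ]}}.
  move=> i; have [|t0 /cid h] := cid (@trim R (G i) r (@G_cont i) r0 _); last by exists t0.
  move=> z; rewrite G0 G1 => h1 h2; have := loopless i.
  by rewrite (sq_disj _ _ _ h1 h2) eqxx.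
pose rt i (b : bool) := if b then t1 i else t0 i.
pose rad i b := G i (rt i b).
have rt01 i b : 0 < rt i b < 1.
  by have [a1 /andP[a2 a3] _ _ _] := tP i; case: b => /=; lra.
have rt_mid i b : t0 i <= rt i b <= t1 i.
  by have [a1 /andP[a2 a3] _ _ _] := tP i; case: b => /=; lra.
have radr i b : `|rad i b - pos (endv i b)| = r.
  by have [_ _ [h1 h2] _ _] := tP i; case: b; rewrite -?G0 -?G1.
have far i s u : t0 i <= s <= t1 i -> `|G i s - pos u| <= r ->
    exists2 b, u = endv i b & s = rt i b.
  have [a1 /andP[a2 a3] _ h1 h2] := tP i; move=> /andP[s0 s1].
  have [ui|ui] := boolP (u \in ends endv i); last first.
    by rewrite leNgt sq_far //; apply/andP; split; lra.
  move: ui; rewrite !inE => /orP[]/eqP ->.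
    rewrite -G0 => le; exists false => //; apply/eqP; rewrite eq_le s0 andbT /= leNgt.
    by apply/negP => lt; move: le; rewrite leNgt h1 //; lra.
  rewrite -G1 => le; exists true => //; apply/eqP; rewrite eq_le s1 /= leNgt.
  by apply/negP => lt; move: le; rewrite leNgt h2 //; lra.
have mid01 i s : t0 i <= s <= t1 i -> 0 < s < 1.
  by have [a1 /andP[a2 a3] _ _ _] := tP i; lra.
have rad_seg i b z : in_seg (pos (endv i b)) (rad i b) z -> `|z - pos (endv i b)| <= r.
  by move=> /in_seg_norm; rewrite radr.
have [e1 e10 E1] : exists2 e : R, 0 < e & forall ij : I * I, ij.1 != ij.2 ->
    forall s t, t0 ij.1 <= s <= t1 ij.1 -> t0 ij.2 <= t <= t1 ij.2 ->
    2 * e <= `|G ij.1 s - G ij.2 t|.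
  apply: (@fin_small _ _ (fun ij e => ij.1 != ij.2 ->
    forall s t, t0 ij.1 <= s <= t1 ij.1 -> t0 ij.2 <= t <= t1 ij.2 ->
    2 * e <= `|G ij.1 s - G ij.2 t|)).
    by move=> ij d e /andP[_ de] h ne s t h1 h2; have := h ne s t h1 h2; lra.
  move=> [i j] /=; have [->|ne] := eqVneq i j; first by exists 1.
  have [|e e0 eP] := @far_apart R (G i) (G j) (t0 i) (t1 i) (t0 j) (t1 j) (@G_cont i) (@G_cont j).
    by move=> s t /mid01 h1 /mid01 h2; apply: G_disj.
  by exists (e / 2) => [|_ s t h1 h2]; [lra|have := eP s t h1 h2; lra].
have [e2 e20 E2] : exists2 e : R, 0 < e & forall ijb : I * I * bool, ijb.1.1 != ijb.1.2 ->
    forall s z, t0 ijb.1.1 <= s <= t1 ijb.1.1 ->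
    in_seg (pos (endv ijb.1.2 ijb.2)) (rad ijb.1.2 ijb.2) z ->
    e <= `|G ijb.1.1 s - z|.
  apply: (@fin_small _ _ (fun ijb e => ijb.1.1 != ijb.1.2 ->
    forall s z, t0 ijb.1.1 <= s <= t1 ijb.1.1 ->
    in_seg (pos (endv ijb.1.2 ijb.2)) (rad ijb.1.2 ijb.2) z ->
    e <= `|G ijb.1.1 s - z|)).
    by move=> ij d e /andP[_ de] h ne s t h1 h2; have := h ne s t h1 h2; lra.
  move=> [[i j] b] /=; have [->|ne] := eqVneq i j; first by exists 1.
  have [|e e0 eP] := @far_apart R (G i) (seg_point (pos (endv j b)) (rad j b))
      (t0 i) (t1 i) 0 1 (@G_cont i) (@seg_point_continuous _ _ _).
    move=> s t sm /andP[h0 h1] e.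
    have nz := seg_point_norm (pos (endv j b)) (rad j b) h0; rewrite radr in nz.
    have [|c uE sE] := far i s (endv j b) sm.
      by rewrite e nz ler_piMl // ltW.
    have tE : t = 1.
      have := radr i c; rewrite /rad -sE -uE e nz => tr.
      by apply: (mulIf (lt0r_neq0 r0)); rewrite tr mul1r.
    move: e; rewrite tE.
    have -> : seg_point (pos (endv j b)) (rad j b) 1 = rad j b.
      by apply: (addIr (- pos (endv j b))); rewrite seg_point_scale scale1r.
    by apply: G_disj ne (mid01 _ _ sm) (rt01 j b).
  exists e => // _ s z sm [t t01 ->]; exact: eP.
(* closer than e to the middle part of an edge there is neither a straight
   piece of another edge nor a vertex, and no point as close to another
   middle part *)
pose e := Num.min (Num.min e1 e2) (r / 2).
have e_gt0 : 0 < e by rewrite !lt_min e10 e20 divr_gt0.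
have ee1 : e <= e1 by rewrite !ge_min lexx.
have ee2 : e <= e2 by rewrite !ge_min lexx orbT.
have er : e < r by rewrite gt_min; apply/orP; right; lra.
have /all_sig[l lP] : forall i, {l : seq R | [/\ last (t0 i) l = t1 i,
    all (fun t => t0 i <= t <= t1 i) l & path (fun s t => `|G i s - G i t| < e) (t0 i) l]}.
  move=> i; apply: cid; apply: eps_chain => //.
  by have [_ /andP[]] := tP i.
pose inner i := map (G i) (l i).
have near i ab z : ab \in inner_segs rad inner i -> in_seg ab.1 ab.2 z ->
    exists2 s, t0 i <= s <= t1 i & `|z - G i s| < e.
  have [_ la lp] := lP i; rewrite /inner_segs /inner /rad /=.
  have: t0 i <= t0 i <= t1 i by have [_ /andP[a2 _] _ _ _] := tP i; rewrite lexx.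
  by move=> h abi zab; apply: chain_near abi zab.
exists rad, inner; split => //.
- by move=> i; have [lE _ _] := lP i; rewrite /rad /inner last_map lE.
- move=> i j ab cd ij abi cdj z /(near _ _ _ abi)[s sm sz] /(near _ _ _ cdj)[t tm tz].
  have := E1 (i, j) ij s t sm tm; rewrite leNgt => /negP; apply.
  by apply: lt_le_trans (dist_lt2 sz tz) _; lra.
- move=> i j b ab ij abi z /(near _ _ _ abi)[s sm sz] zr.
  have := E2 (i, j, b) ij s z sm zr; rewrite /= distrC leNgt => /negP; apply.
  exact: lt_le_trans sz ee2.
- move=> i j b c z ij z1 z2.
  have uv : endv i b = endv j c.
    by apply: (sq_disj _ _ z); apply: rad_seg.
  split=> //; move: z1 z2 => [s s01 z1] [t t01 z2].
  have [/andP[s0 _] /andP[t_0 _]] := (s01, t01).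
  have n1 : `|z - pos (endv i b)| = s * r by rewrite z1 -(radr i b) -seg_point_norm.
  have n2 : `|z - pos (endv i b)| = t * r by rewrite z2 uv -(radr j c) -seg_point_norm.
  have st : s = t by apply: (mulIf (lt0r_neq0 r0)); rewrite -n1 -n2.
  have [s_0|s_0] := eqVneq s 0.
    by rewrite z1 s_0 !mul0r !addr0; case: (pos _).
  exfalso; apply: (@G_disj i j (rt i b) (rt j c) ij) => //.
  have : s *: (rad i b - pos (endv i b)) = s *: (rad j c - pos (endv i b)).
    by rewrite {2}st {2}uv -!seg_point_scale /seg_point -z1 -z2 uv.
  by move=> /(scalerI s_0) /addIr.
- move=> i ab u abi /(near _ _ _ abi)[s sm sz].
  have [|b ub sb] := far i s u sm; first by rewrite distrC ltW // (lt_trans sz).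
  have := radr i b; rewrite /rad -sb -ub distrC => e3.
  by move: sz; rewrite e3; lra.
- move=> i b u /rad_seg h; apply/esym/(sq_disj _ _ (pos u)) => //.
  by rewrite subrr normr0 ltW.
- by move=> i b; rewrite -subr_eq0 -normr_gt0 radr.
Qed.

End Arcs.

(** * Triangle-free planar graphs *)

Section Planar.
Variables (R : realType) (T : finType) (e : rel T).
Hypotheses (e_sym : symmetric e) (e_irr : irreflexive e).
Hypothesis e_K3_free : K3_free e.

Lemma edge_ends (pos : T -> R * R) (h : R -> R * R) (E : {set T}) : injective pos ->
  E \in edges e -> jordan_arc h -> ([set h 0; h 1] = pos @` [set` E])%classic ->
  exists x y, [/\ e x y, E = [set x; y]%SET, h 0 = pos x & h 1 = pos y].
Proof.
move=> pinj /imsetP[[x y]]; rewrite inE /= => exy EE [_ hinj] im.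
have [a aE h0] : exists2 a, a \in E & pos a = h 0.
  have : [set h 0; h 1]%classic (h 0) by left.
  by rewrite im => -[a /= aE <-]; exists a.
have [b bE h1] : exists2 b, b \in E & pos b = h 1.
  have : [set h 0; h 1]%classic (h 1) by right.
  by rewrite im => -[b /= bE <-]; exists b.
have ab : a != b.
  apply/eqP => ab; have : h 0 = h 1 by rewrite -h0 -h1 ab.
  by move=> /hinj; rewrite !in_itv /= !lexx !ler01 => /(_ isT isT)/eqP; rewrite eq_sym oner_eq0.
exists a, b; split=> //; move: aE bE ab; rewrite EE !inE.
  by move=> /orP[]/eqP-> /orP[]/eqP->; rewrite ?eqxx // e_sym.
by move=> /orP[]/eqP-> /orP[]/eqP->; rewrite ?eqxx // finset.setUC.
Qed.

(** The edges inside S inherit the drawing; every ordered pair of adjacent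
    vertices is determined by its edge and by which end comes first. *)
Lemma planar_degree_sum (S : {set T}) : planar R e -> (3 <= #|S|)%N ->
  (\sum_(x in S) #|nbrs_in e S x| + 8 <= 4 * #|S|)%N.
Proof.
move=> [pos [g [pinj arcs avoid cross]]] S3.
pose I := {E : {set T} | (E \in edges e) && (E \subset S)}.
have /all_sig[ab abP] : forall i : I, {ab : T * T | [/\ e ab.1 ab.2, val i = [set ab.1; ab.2]%SET,
    g (val i) 0 = pos ab.1 & g (val i) 1 = pos ab.2]}.
  move=> [E /= /andP[Ee ES]]; apply: cid; have [ja im] := arcs E Ee.
  by have [x [y h]] := edge_ends pinj Ee ja im; exists (x, y).
have /all_sig2[G Gc Gg] : forall i : I, {G : R -> R * R | continuous G
    & {in `[0, 1], forall t, G t = g (val i) t}}.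
  move=> [E /= /andP[Ee ES]]; apply: cid2; have [[cg _] _] := arcs E Ee.
  by apply: clamp_extension.
have edge_i (i : I) : val i \in edges e by case/andP: (valP i).
have sub_i (i : I) : val i \subset S by case/andP: (valP i).
pose endv (i : I) (b : bool) := if b then (ab i).2 else (ab i).1.
have endsE (i : I) : ends endv i = val i by have [_ -> _ _] := abP i.
have G0 (i : I) : G i 0 = pos (endv i false).
  by have [_ _ <- _] := abP i; apply: Gg; rewrite in_itv /= lexx ler01.
have G1 (i : I) : G i 1 = pos (endv i true).
  by have [_ _ _ <-] := abP i; apply: Gg; rewrite in_itv /= lexx ler01.
have loopless (i : I) : endv i false != endv i true.
  by have [h _ _ _] := abP i; apply: contraTneq h => /= ->; rewrite e_irr.
have G_in (i : I) t : 0 < t < 1 -> (g (val i) @` `]0, 1[)%classic (G i t).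
  move=> t01; exists t => /=; first by rewrite in_itv.
  by apply/esym/Gg; rewrite in_itv /=; lra.
have G_pos (i : I) t u : 0 < t < 1 -> G i t <> pos u.
  by move=> /G_in h hu; apply: (avoid (val i) u (edge_i i)); rewrite -hu.
have G_disj (i j : I) s t : i != j -> 0 < s < 1 -> 0 < t < 1 -> G i s <> G j t.
  move=> ij /(G_in i) h1 /(G_in j) h2 h.
  have := cross _ _ (edge_i i) (edge_i j); rewrite (inj_eq val_inj) => /(_ ij) c0.
  have : (set0 : set (R * R)) (G i s) by rewrite -c0; split=> //; rewrite h.
  by [].
have [rad [inner cl]] := clean_of_arcs loopless pinj Gc G0 G1 G_pos G_disj.
have adj (i : I) x y : ends endv i = [set x; y]%SET -> e x y.
  have [exy E _ _] := abP i; rewrite endsE E => /setP xyE.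
  have := xyE x; have := xyE y; have := xyE (ab i).1; have := xyE (ab i).2.
  have ne : (ab i).1 != (ab i).2 by apply: contraTneq exy => ->; rewrite e_irr.
  rewrite !inE !eqxx ?orbT /= => h1 h2 h3 h4.
  case/orP: h3 => /eqP yE; case/orP: h4 => /eqP xE; rewrite ?yE ?xE //.
  - by move: h1; rewrite yE xE orbb eq_sym (negbTE ne).
  - by rewrite e_sym.
  - by move: h2; rewrite yE xE orbb (negbTE ne).
have eul : (#|{: I}| + 4 <= 2 * #|S|)%N.
  apply: (clean_euler cl) => //.
  - by move=> i j; rewrite !endsE => /val_inj.
  - move=> a b c i j k /adj h1 /adj h2 /adj h3; exact: (e_K3_free (And3 h1 h2 h3)).
  - move=> i b; apply: (fintype.subsetP (sub_i i)); rewrite -endsE !inE.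
    by case: b; rewrite eqxx ?orbT.
suff : (\sum_(x in S) #|nbrs_in e S x| <= 2 * #|{: I}|)%N by lia.
pose P := [set xy : T * T | [&& xy.1 \in S, xy.2 \in S & e xy.1 xy.2]]%SET.
have -> : (\sum_(x in S) #|nbrs_in e S x| = #|P|)%N.
  rewrite -sum1_card (eq_bigl (fun xy : T * T => (xy.1 \in S) && (xy.2 \in nbrs_in e S xy.1))); last first.
    by move=> [x y]; rewrite !inE.
  rewrite -(pair_big_dep (fun x => x \in S) (fun x y => y \in nbrs_in e S x) (fun _ _ => 1%N)) /=.
  by apply: eq_bigr => x _; rewrite sum1_card.
have mkI xy : xy \in P -> {i : I | val i = [set xy.1; xy.2]%SET}.
  move=> h; apply: cid; move: h; rewrite inE => /and3P[xS yS exy].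
  have h : ([set xy.1; xy.2]%SET \in edges e) && ([set xy.1; xy.2]%SET \subset S).
    apply/andP; split; first by apply/imsetP; exists xy; rewrite // inE.
    by apply/fintype.subsetP => z; rewrite !inE => /orP[]/eqP->.
  by exists (@exist {set T} (fun E => (E \in edges e) && (E \subset S)) _ h).
pose f (xy : T * T) : option (I * bool) :=
  omap (fun i => (i, xy.1 == endv i true)) [pick i : I | val i == [set xy.1; xy.2]%SET].
have fP xy : xy \in P -> exists i, f xy = Some (i, xy.1 == endv i true) /\ val i = [set xy.1; xy.2]%SET.
  move=> /mkI[i0 i0E]; rewrite /f; case: pickP => [i /eqP iE|/(_ i0)] /=; first by exists i.
  by rewrite i0E eqxx.
have finj : {in P &, injective f}.
  move=> [x y] [x' y'] /fP[i [-> iE]] /fP[j [-> jE]] /= [ij xx]; subst j.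
  have := loopless i; move: iE jE xx; rewrite -endsE /= => iE jE xx ne.
  have m (u v : T) : ends endv i = [set u; v]%SET -> (u = endv i true /\ v = endv i false) \/
      (u = endv i false /\ v = endv i true).
    move=> uv; have := adj i u v uv; move/setP: uv => uv euv.
    have uvn : u != v by apply: contraTneq euv => ->; rewrite e_irr.
    have := uv u; have := uv v; rewrite !inE !eqxx ?orbT /=.
    move=> /orP[]/eqP v1 /orP[]/eqP u1; subst; rewrite ?eqxx in uvn; by [left|right|].
  case: (m _ _ iE) => -[-> ->] in xx *; case: (m _ _ jE) => -[-> ->] in xx * => //;
  by move: xx; rewrite eqxx (negbTE ne).
rewrite -(card_in_imset finj).
have : f @: P \subset [set Some h | h : I * bool]%SET.
  by apply/fintype.subsetP => _ /imsetP[xy /fP[i [-> _]] ->]; apply/imsetP; exists (i, xy.1 == endv i true).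
move=> /subset_leq_card /leq_trans; apply.
by apply: leq_trans (leq_imset_card _ _) _; rewrite card_prod card_bool mulnC.
Qed.

End Planar.

(** * Covering paths on three vertices *)

Section Covers.
Variables (T : finType) (e : rel T).
Hypotheses (e_sym : symmetric e) (e_irr : irreflexive e).

(** The middle vertex of a path inside D would have two neighbours in D. *)
Lemma dissociation_cover (D : {set T}) :
  dissociation e D -> kpath_vertex_cover e 3 (~: D)%SET.
Proof.
move=> dD; apply/existsPn => p; apply/negP => /andP[/andP[up sp] /allP pD].
case: p up sp pD => -[|x [|y [|z []]]] // sz /= up /and3P[exy eyz _] pD.
have inD v : v \in [:: x; y; z] -> v \in D.
  by move=> /pD; rewrite !finset.inE negbK.
have xz : x != z by move: up; rewrite !finset.inE !negb_or -!andbA => /and4P[_ ->].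
have := dD y (inD y _); rewrite !finset.inE eqxx orbT => /(_ isT).
suff : ([set x; z] \subset nbrs_in e D y)%SET by move=> /subset_leq_card; rewrite cards2 xz; lia.
apply/fintype.subsetP => v; rewrite !finset.inE => /orP[]/eqP->.
  by rewrite inD ?mem_head // e_sym.
by rewrite inD // !in_cons eqxx !orbT.
Qed.

Lemma psi_le_dissociation (D : {set T}) : dissociation e D -> (psi e 3 + #|D| <= #|T|)%N.
Proof.
move=> dD; have [_ /(_ _ (dissociation_cover dD))] := psiP e (isT : (0 < 3)%N).
by rewrite -(cardsC D); lia.
Qed.

End Covers.

Theorem corollary28 (R : realType) (T : finType) (e : rel T)
  (e_sym : symmetric e) (e_irr : irreflexive e)
  (T_gt0 : (0 < #|T|)%N)
  (e_planar : planar R e) (e_K3_free : K3_free e) :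
  (psi e 3)%:R <= 121 / 192 * #|T|%:R - 3 / 8 :> R.
Proof.
have sparse S := planar_degree_sum e_sym e_irr e_K3_free (S := S) e_planar.
have no4 (S : {set T}) : S != finset.set0 -> exists2 x, x \in S & #|nbrs_in e S x| != 4%N.
  move=> S0; apply: contrapT => all4.
  have {}all4 x : x \in S -> #|nbrs_in e S x| = 4%N.
    by move=> xS; apply/eqP/negPn/negP => ne; apply: all4; exists x.
  have [/sparse|lt3] := leqP 3 #|S|.
    by rewrite (eq_bigr _ all4) sum_nat_const; lia.
  have /set0Pn[x xS] := S0; have := all4 x xS.
  have : (#|nbrs_in e S x| <= #|S|)%N.
    by apply: subset_leq_card; apply/fintype.subsetP => y; rewrite finset.inE => /andP[].
  lia.
have [D [_ dD le]] := dissociation_bound e_sym e_irr e_K3_free no4 [set: T]%SET.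
have psiD := psi_le_dissociation e_sym dD.
rewrite cardsT in le.
suff bound : (384 * psi e 3 + 144 <= 242 * #|T|)%N.
  have : (384 * psi e 3 + 144)%:R <= (242 * #|T|)%:R :> R by rewrite ler_nat.
  by rewrite natrD !natrM; lra.
have [n3|n2] := leqP 3 #|T|.
  have := sparse [set: T]%SET; rewrite cardsT => /(_ n3).
  move: le; rewrite /degsum; lia.
have : (psi e 3 <= 0)%N.
  have [_ psi_min] := psiP e (isT : (0 < 3)%N).
  have := psi_min finset.set0; rewrite cards0; apply; apply/existsPn => p; apply/negP.
  move=> /andP[/andP[/card_uniqP up _] _].
  by have := max_card (mem p); rewrite up size_tuple; lia.
lia.
Qed.
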